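(* Let $v\in kQ_0$ be a regular weight and let $M$ be an indecomposable non-injective $A$-module. Then the morphism ${}^v\varrho_M: M\to {}^v\Lambda_1\otimes_A M$ is injective and the sequence $$0\to M\xrightarrow{\ {}^v\varrho_M\ }{}^v\Lambda_1\otimes_A M\xrightarrow{\ {}^v\pi_{1,M}\ }\Pi_1\otimes_A M\to 0$$ (where $\Pi_1\otimes_A M\cong\tau_1^{-1}M$) is an Auslander-Reiten sequence starting from $M$.
   Context: $k$ is a field; $Q=(Q_0,Q_1,h,t)$ is a finite connected acyclic quiver, an arrow $\alpha$ going from its tail $t(\alpha)$ to its head $h(\alpha)$. Paths are composed from left to right ($\alpha\beta$ is defined when $h(\alpha)=t(\beta)$), $e_i$ is the trivial path at $i$. $A=kQ$; modules are finite-dimensional left modules. $\tau_1^{-1}$ is the inverse Auslander-Reiten translation; by a known result the functor $\Pi_1\otimes_A-$ (with $\Pi_1$ below) is isomorphic to $\tau_1^{-1}$ on $A$-modules. A weight is an element $v=(v_i)\in kQ_0=k^{Q_0}$; it is sincere if all $v_i\neq 0$, and regular if $\sum_{i\in Q_0}v_i\dim(e_iN)\ne 0$ in $k$ for every indecomposable $A$-module $N$ (so regular implies sincere). $\overline Q$ is the double of $Q$: add for each $\alpha\in Q_1$ an arrow $\alpha^*:h(\alpha)\to t(\alpha)$. Put $\rho_i=\sum_{t(\alpha)=i}\alpha\alpha^*-\sum_{h(\alpha)=i}\alpha^*\alpha$ ($\alpha\in Q_1$), and $\Pi=k\overline Q/(\rho_i\mid i\in Q_0)$. For $v$ sincere put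 ${}^v\varrho_i=v_i^{-1}\rho_i$, ${}^v\varrho=\sum_i{}^v\varrho_i$, ${}^v\eta_a=a\,{}^v\varrho-{}^v\varrho\,a$ for every arrow $a$ of $\overline Q$, and ${}^v\Lambda=k\overline Q/({}^v\eta_a\mid a\in\overline Q_1)$ (the quiver Heisenberg algebra). Both algebras are graded by $\deg^*\alpha=0$, $\deg^*\alpha^*=1$; $\Pi_n,{}^v\Lambda_n$ are the degree $n$ parts; $\Pi_0={}^v\Lambda_0=A$, so these are $A$-bimodules. ${}^v\varrho$ is central in ${}^v\Lambda$, of degree $1$. ${}^v\varrho:A\to{}^v\Lambda_1$ denotes the bimodule morphism $x\mapsto x\,{}^v\varrho$, ${}^v\pi_1:{}^v\Lambda_1\to\Pi_1$ the canonical projection, ${}^v\varrho_M={}^v\varrho\otimes_AM$, ${}^v\pi_{1,M}={}^v\pi_1\otimes_AM$. *)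

(* Defs.v *)
From HB Require Import structures.
From mathcomp Require Import all_boot all_order all_algebra finmap.
From mathcomp.multinomials Require Import monalg.
From mathcomp Require Import boolp.

Set Implicit Arguments.
Unset Strict Implicit.
Unset Printing Implicit Defensive.

Import GRing.Theory.
Local Open Scope ring_scope.
Local Open Scope quotient_scope.

Section Span.
Variables (R : pzRingType) (V : lmodType R).

Definition span (S : V -> Prop) : {pred V} := fun x =>
  `[< forall P : {pred V}, GRing.submod_closed P ->
      (forall s, S s -> s \in P) -> x \in P >].

Lemma span_sub (S : V -> Prop) s : S s -> s \in span S.
Proof. by move=> Ss; apply/asboolP => P _; apply. Qed.

Lemma span_submod_closed S : GRing.submod_closed (span S).
Proof.
split=> [|a x y /asboolP Sx /asboolP Sy]; apply/asboolP => P Pc SP.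
  exact: Pc.1.
by apply: Pc.2; [exact: Sx | exact: Sy].
Qed.

HB.instance Definition _ S :=
  GRing.isSubmodClosed.Build R V (span S) (span_submod_closed S).

Variable S : V -> Prop.

Definition lquot : Type := @Quotient.quot V (span S).
HB.instance Definition _ := GRing.Zmodule.on lquot.

Definition lq_pi (x : V) : lquot := \pi_(@Quotient.quot V (span S)) x.

Lemma lq_piB : {morph lq_pi : x y / x - y}.
Proof. by move=> x y; rewrite /lq_pi !piE. Qed.

Lemma lq_piD : {morph lq_pi : x y / x + y}.
Proof. by move=> x y; rewrite /lq_pi !piE. Qed.

Lemma lq_pi_eq x y : (lq_pi x == lq_pi y) = (x - y \in span S).
Proof. by rewrite Quotient.idealrBE. Qed.

Lemma lq_reprK : cancel (fun t : lquot => repr t) lq_pi.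
Proof. by move=> t; rewrite /lq_pi reprK. Qed.

Definition lq_scale (a : R) (t : lquot) : lquot := lq_pi (a *: repr t).

Lemma lq_scaleE a x : lq_scale a (lq_pi x) = lq_pi (a *: x).
Proof.
apply/eqP; rewrite lq_pi_eq -scalerBr rpredZ // -lq_pi_eq.
by rewrite lq_reprK.
Qed.

Lemma lq_ind (P : lquot -> Prop) : (forall x, P (lq_pi x)) -> forall t, P t.
Proof. by move=> h t; rewrite -[t]lq_reprK. Qed.

Fact lq_scaleA a b t : lq_scale a (lq_scale b t) = lq_scale (a * b) t.
Proof. by elim/lq_ind: t => x; rewrite !lq_scaleE scalerA. Qed.

Fact lq_scale1 : left_id 1 lq_scale.
Proof. by elim/lq_ind => x; rewrite lq_scaleE scale1r. Qed.

Fact lq_scaleDr : right_distributive lq_scale +%R.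
Proof.
move=> a; elim/lq_ind => x; elim/lq_ind => y.
by rewrite -lq_piD !lq_scaleE -lq_piD scalerDr.
Qed.

Fact lq_scaleDl t : {morph lq_scale^~ t : a b / a + b}.
Proof. by elim/lq_ind: t => x a b; rewrite !lq_scaleE -lq_piD scalerDl. Qed.

HB.instance Definition _ := GRing.Zmodule_isLmodule.Build R lquot
  lq_scaleA lq_scale1 lq_scaleDr lq_scaleDl.

Fact lq_pi_is_linear : linear lq_pi.
Proof. by move=> a x y; rewrite lq_piD -lq_scaleE. Qed.

HB.instance Definition _ :=
  GRing.isLinear.Build R V lquot _ lq_pi lq_pi_is_linear.

Section Lift.
Variables (W : lmodType R) (g : {linear V -> W}).
Hypothesis gS : forall s, S s -> g s = 0.

Definition lq_lift (t : lquot) : W := g (repr t).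

Lemma lq_liftE x : lq_lift (lq_pi x) = g x.
Proof.
have : repr (lq_pi x) - x \in span S by rewrite -lq_pi_eq lq_reprK.
move=> /asboolP /(_ (fun y => g y == 0)) h.
apply/eqP; rewrite -subr_eq0 -linearB; apply: h => [|y /gS /eqP //].
split=> [|a y z /eqP gy /eqP gz]; first by rewrite unfold_in linear0.
by rewrite unfold_in linearP gy gz scaler0 addr0.
Qed.

End Lift.

End Span.

Section LiftLinear.
Variables (R : pzRingType) (V W : lmodType R) (S : V -> Prop).
Variables (g : {linear V -> W}) (gS : forall s, S s -> g s = 0).

Fact lq_lift_is_linear : linear (@lq_lift R V S W g).
Proof.
move=> a; elim/lq_ind => x; elim/lq_ind => y.
by rewrite -linearP !(lq_liftE gS) linearP.
Qed.

Definition lq_map : lquot S -> W := let _ := gS in @lq_lift R V S W g.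

HB.instance Definition _ :=
  GRing.isLinear.Build R (lquot S) W _ lq_map lq_lift_is_linear.

Lemma lq_mapE x : lq_map (lq_pi S x) = g x.
Proof. exact: lq_liftE. Qed.

End LiftLinear.

Arguments lq_map : simpl never.

Section IdealQuotient.
Variable R : pzRingType.

Definition ideal (S : R -> Prop) : {pred R} := fun x =>
  `[< forall P : {pred R}, zmod_closed P ->
      (forall a y b, y \in P -> a * y * b \in P) ->
      (forall s, S s -> s \in P) -> x \in P >].

Lemma ideal_sub (S : R -> Prop) s : S s -> s \in ideal S.
Proof. by move=> Ss; apply/asboolP => P _ _ h; exact: h. Qed.

Lemma ideal_zmod_closed S : zmod_closed (ideal S).
Proof.
split=> [|x y /asboolP Sx /asboolP Sy]; apply/asboolP => P Pc PM SP.
  exact: Pc.1.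
by apply: Pc.2; [exact: Sx | exact: Sy].
Qed.

HB.instance Definition _ S :=
  GRing.isZmodClosed.Build R (ideal S) (ideal_zmod_closed S).

Lemma idealM S a x b : x \in ideal S -> a * x * b \in ideal S.
Proof.
by move=> /asboolP Sx; apply/asboolP => P Pc PM SP; apply: (PM); exact: Sx.
Qed.

Variable S : R -> Prop.

Definition rquot : Type := @Quotient.quot R (ideal S).
HB.instance Definition _ := GRing.Zmodule.on rquot.

Definition rq_pi (x : R) : rquot := \pi_(@Quotient.quot R (ideal S)) x.

Lemma rq_piB : {morph rq_pi : x y / x - y}.
Proof. by move=> x y; rewrite /rq_pi !piE. Qed.

Lemma rq_piD : {morph rq_pi : x y / x + y}.
Proof. by move=> x y; rewrite /rq_pi !piE. Qed.

Lemma rq_pi_eq x y : (rq_pi x == rq_pi y) = (x - y \in ideal S).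
Proof. by rewrite Quotient.idealrBE. Qed.

Lemma rq_reprK : cancel (fun t : rquot => repr t) rq_pi.
Proof. by move=> t; rewrite /rq_pi reprK. Qed.

Lemma rq_ind (P : rquot -> Prop) : (forall x, P (rq_pi x)) -> forall t, P t.
Proof. by move=> h t; rewrite -[t]rq_reprK. Qed.

Definition rq_mul (s t : rquot) : rquot := rq_pi (repr s * repr t).

Lemma rq_mulE x y : rq_mul (rq_pi x) (rq_pi y) = rq_pi (x * y).
Proof.
apply/eqP; rewrite rq_pi_eq.
set x' := repr _; set y' := repr _.
have hx : x' - x \in ideal S by rewrite -rq_pi_eq rq_reprK.
have hy : y' - y \in ideal S by rewrite -rq_pi_eq rq_reprK.
have -> : x' * y' - x * y = 1 * (x' - x) * y' + x * (y' - y) * 1.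
  by rewrite mul1r mulr1 mulrBl mulrBr addrA subrK.
by rewrite rpredD // idealM.
Qed.

Fact rq_mulA : associative rq_mul.
Proof.
elim/rq_ind => x; elim/rq_ind => y; elim/rq_ind => z.
by rewrite !rq_mulE mulrA.
Qed.

Fact rq_mul1l : left_id (rq_pi 1) rq_mul.
Proof. by elim/rq_ind => x; rewrite rq_mulE mul1r. Qed.

Fact rq_mul1r : right_id (rq_pi 1) rq_mul.
Proof. by elim/rq_ind => x; rewrite rq_mulE mulr1. Qed.

Fact rq_mulDl : left_distributive rq_mul +%R.
Proof.
elim/rq_ind => x; elim/rq_ind => y; elim/rq_ind => z.
by rewrite -rq_piD !rq_mulE -rq_piD mulrDl.
Qed.

Fact rq_mulDr : right_distributive rq_mul +%R.
Proof.
elim/rq_ind => x; elim/rq_ind => y; elim/rq_ind => z.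
by rewrite -rq_piD !rq_mulE -rq_piD mulrDr.
Qed.

HB.instance Definition _ := GRing.Zmodule_isPzRing.Build rquot
  rq_mulA rq_mul1l rq_mul1r rq_mulDl rq_mulDr.

Fact rq_pi_is_zmod_morphism : zmod_morphism rq_pi.
Proof. exact: rq_piB. Qed.

Fact rq_pi_is_monoid_morphism : monoid_morphism rq_pi.
Proof. by split=> // x y; rewrite -rq_mulE. Qed.

HB.instance Definition _ :=
  GRing.isZmodMorphism.Build R rquot rq_pi rq_pi_is_zmod_morphism.
HB.instance Definition _ :=
  GRing.isMonoidMorphism.Build R rquot rq_pi rq_pi_is_monoid_morphism.

End IdealQuotient.

Section FreeModule.
Variables (R : nzRingType) (K : choiceType).

(* The operations of {malg R[K]} are locked, as failing unification would
   otherwise unfold finitely supported functions *)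
Definition fmod : Type := {malg R[K]}.
HB.instance Definition _ := Choice.on fmod.

Fact fm_zero_key : unit. Proof. by []. Qed.
Fact fm_opp_key : unit. Proof. by []. Qed.
Fact fm_add_key : unit. Proof. by []. Qed.
Fact fm_scale_key : unit. Proof. by []. Qed.
Fact fm_base_key : unit. Proof. by []. Qed.

Definition fm_zero : fmod := locked_with fm_zero_key (0 : {malg R[K]}).
Definition fm_opp : fmod -> fmod :=
  locked_with fm_opp_key (fun f : {malg R[K]} => - f).
Definition fm_add : fmod -> fmod -> fmod :=
  locked_with fm_add_key (fun f g : {malg R[K]} => f + g).
Definition fm_scale : R -> fmod -> fmod :=
  locked_with fm_scale_key (fun a (f : {malg R[K]}) => a *: f).
Definition fm_base : K -> fmod :=
  locked_with fm_base_key (fun x => << x >> : {malg R[K]}).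

Fact fm_zeroE : fm_zero = (0 : {malg R[K]}).
Proof. exact: unlock. Qed.
Fact fm_oppE f : fm_opp f = - (f : {malg R[K]}).
Proof. by rewrite /fm_opp unlock. Qed.
Fact fm_addE f g : fm_add f g = (f : {malg R[K]}) + g.
Proof. by rewrite /fm_add unlock. Qed.
Fact fm_scaleE a f : fm_scale a f = a *: (f : {malg R[K]}).
Proof. by rewrite /fm_scale unlock. Qed.
Fact fm_baseE x : fm_base x = (<< x >> : {malg R[K]}).
Proof. by rewrite /fm_base unlock. Qed.

Fact fm_addA : associative fm_add.
Proof. by move=> f g h; rewrite !fm_addE addrA. Qed.
Fact fm_addC : commutative fm_add.
Proof. by move=> f g; rewrite !fm_addE addrC. Qed.
Fact fm_add0 : left_id fm_zero fm_add.
Proof. by move=> f; rewrite fm_addE fm_zeroE add0r. Qed.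
Fact fm_addN : left_inverse fm_zero fm_opp fm_add.
Proof. by move=> f; rewrite fm_addE fm_oppE fm_zeroE addNr. Qed.
HB.instance Definition _ := GRing.isZmodule.Build fmod
  fm_addA fm_addC fm_add0 fm_addN.

Fact fm_scaleA a b f : fm_scale a (fm_scale b f) = fm_scale (a * b) f.
Proof. by rewrite !fm_scaleE scalerA. Qed.
Fact fm_scale1 : left_id 1 fm_scale.
Proof. by move=> f; rewrite fm_scaleE scale1r. Qed.
Fact fm_scaleDr : right_distributive fm_scale +%R.
Proof.
move=> a f g; rewrite !fm_scaleE.
by rewrite [LHS](_ : _ = a *: fm_add f g) // [RHS]fm_addE fm_addE scalerDr.
Qed.
Fact fm_scaleDl f : {morph fm_scale^~ f : a b / a + b}.
Proof. by move=> a b; rewrite [RHS]fm_addE !fm_scaleE scalerDl. Qed.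
HB.instance Definition _ := GRing.Zmodule_isLmodule.Build R fmod
  fm_scaleA fm_scale1 fm_scaleDr fm_scaleDl.

Lemma fm_ind (P : fmod -> Prop) :
  P 0 -> (forall a x f, P f -> P (a *: fm_base x + f)) -> forall f, P f.
Proof.
move=> P0 PD f; rewrite [f](@monalgE K R).
elim: (enum_fset (msupp f)) => [|x s IH].
  by rewrite big_nil -fm_zeroE.
rewrite big_cons; suff <- : fm_scale f@_x (fm_base x) = << f@_x *g x >>.
  by rewrite -fm_addE; exact: PD.
rewrite fm_scaleE fm_baseE; apply/malgP => y.
by rewrite mcoeffZ !mcoeffU mulrnAr mulr1.
Qed.

Section LinearExtension.
Variables (V : lmodType R) (phi : K -> V).

Definition lext (f : fmod) : V :=
  \sum_(x <- msupp (f : {malg R[K]})) (f : {malg R[K]})@_x *: phi x.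

Lemma lextEw (f : {malg R[K]}) (D : {fset K}) :
  (msupp f `<=` D)%fset -> lext f = \sum_(x <- D) f@_x *: phi x.
Proof.
move=> sfD; apply: big_fset_incl => // x _ /mcoeff_outdom ->.
by rewrite scale0r.
Qed.

Fact lext_is_linear : linear lext.
Proof.
move=> a f g; rewrite [a *: f + g]fm_addE [a *: f]fm_scaleE.
set h : {malg R[K]} := _ + _.
pose D := (msupp h `|` msupp (f : {malg R[K]}) `|` msupp (g : {malg R[K]}))%fset.
have s1 : (msupp h `<=` D)%fset by rewrite /D -fsetUA fsubsetUl.
have s2 : (msupp (f : {malg R[K]}) `<=` D)%fset.
  by rewrite /D -fsetUA fsetUCA fsubsetUl.
have s3 : (msupp (g : {malg R[K]}) `<=` D)%fset by rewrite /D fsubsetUr.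
rewrite (lextEw s1) (lextEw s2) (lextEw s3).
rewrite scaler_sumr -big_split /=; apply: eq_bigr => x _.
by rewrite mcoeffD mcoeffZ scalerDl scalerA.
Qed.

HB.instance Definition _ := GRing.isLinear.Build R fmod V _ lext lext_is_linear.

Lemma lextU x : lext (fm_base x) = phi x.
Proof.
rewrite fm_baseE /lext msuppU oner_eq0 big_seq_fset1 mcoeffUU.
by rewrite scale1r.
Qed.

End LinearExtension.

End FreeModule.

Record quiver := Quiver {
  vert : finType;
  arr : finType;
  tail : arr -> vert;
  head : arr -> vert;
  vert_gt0 : (0 < #|vert|)%N
}.

Section Paths.
Variable Q : quiver.

Definition linked : rel (vert Q) := fun i j =>
  [exists a : arr Q, ((tail a == i) && (head a == j))
                  || ((tail a == j) && (head a == i))].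

Definition connected : Prop := forall i j : vert Q, connect linked i j.

Fixpoint walk (i : vert Q) (s : seq (arr Q)) : bool :=
  if s is a :: s' then (tail a == i) && walk (head a) s' else true.

Definition walk_end (i : vert Q) (s : seq (arr Q)) : vert Q :=
  last i (map (@head Q) s).

Lemma walk_cat i s1 s2 :
  walk i (s1 ++ s2) = walk i s1 && walk (walk_end i s1) s2.
Proof. by elim: s1 i => //= a s IH i; rewrite IH andbA. Qed.

Lemma walk_end_cat i s1 s2 :
  walk_end i (s1 ++ s2) = walk_end (walk_end i s1) s2.
Proof. by rewrite /walk_end map_cat last_cat. Qed.

(* The source is recorded separately so that the trivial paths at distinct
   vertices differ *)
Record qpath := QPath {
  qpath_val : vert Q * seq (arr Q);
  qpath_walk : walk qpath_val.1 qpath_val.2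
}.

HB.instance Definition _ := [isSub for qpath_val].
HB.instance Definition _ := [Choice of qpath by <:].

Definition psrc (p : qpath) : vert Q := (val p).1.
Definition parr (p : qpath) : seq (arr Q) := (val p).2.
Definition ptgt (p : qpath) : vert Q := walk_end (psrc p) (parr p).

Definition acyclic : Prop :=
  forall p : qpath, parr p != [::] -> psrc p != ptgt p.

Definition trivial_path (i : vert Q) : qpath :=
  @QPath (i, [::]) isT.

Fact arrow_path_subproof (a : arr Q) : walk (tail a) [:: a].
Proof. by rewrite /= eqxx. Qed.

Definition arrow_path (a : arr Q) : qpath :=
  @QPath (tail a, [:: a]) (arrow_path_subproof a).

Definition pconc (p q : qpath) : option qpath :=
  if ptgt p == psrc q then insub (psrc p, parr p ++ parr q) else None.

Lemma pconc_some p q : ptgt p = psrc q ->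
  exists2 r, pconc p q = Some r & val r = (psrc p, parr p ++ parr q).
Proof.
move=> pq; rewrite /pconc pq eqxx; case: insubP => [r _ rE|]; first by exists r.
by rewrite /= walk_cat -/(ptgt p) pq (valP p) (valP q).
Qed.

Lemma pconc_none p q : ptgt p != psrc q -> pconc p q = None.
Proof. by rewrite /pconc => /negPf ->. Qed.

Lemma pconcA p q r :
  obind (pconc p) (pconc q r) = obind (pconc^~ r) (pconc p q).
Proof.
have [qr|nqr] := eqVneq (ptgt q) (psrc r); last first.
  rewrite (pconc_none nqr) /=.
  have [pq|npq] := eqVneq (ptgt p) (psrc q); last by rewrite pconc_none.
  have [x -> xE] := pconc_some pq; rewrite /= pconc_none //.
  by rewrite /ptgt /psrc /parr xE /= walk_end_cat -/(ptgt p) pq.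
have [x -> xE] := pconc_some qr; rewrite /=.
have sx : psrc x = psrc q by rewrite /psrc xE.
have [pq|npq] := eqVneq (ptgt p) (psrc q); last first.
  by rewrite !pconc_none //= sx.
have [y -> yE] := pconc_some pq; rewrite /=.
have ty : ptgt y = psrc r.
  by rewrite /ptgt /psrc /parr yE /= walk_end_cat -/(ptgt p) pq -/(ptgt q) qr.
have [|z -> zE] := @pconc_some p x; first by rewrite sx.
have [w -> wE] := pconc_some ty.
congr Some; apply: val_inj; rewrite zE wE /psrc /parr xE yE /=.
by rewrite catA.
Qed.

Lemma pconc1p i p : pconc (trivial_path i) p = if i == psrc p then Some p else None.
Proof.
have [ip|nip] := eqVneq i (psrc p); last by rewrite pconc_none.
have [|x -> xE] := @pconc_some (trivial_path i) p; first by [].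
by congr Some; apply: val_inj; rewrite xE {x xE} /psrc /= ip; case: p {ip} => -[].
Qed.

Lemma pconcp1 i p : pconc p (trivial_path i) = if i == ptgt p then Some p else None.
Proof.
have [ip|nip] := eqVneq i (ptgt p); last by rewrite pconc_none // eq_sym.
have [|x -> xE] := @pconc_some p (trivial_path i); first by [].
congr Some; apply: val_inj; rewrite xE /= cats0.
by case: p {ip x xE} => -[].
Qed.

End Paths.

Section PathAlgebra.
Variables (k : fieldType) (Q : quiver).

Definition path_alg : Type := fmod k (qpath Q).
HB.instance Definition _ := GRing.Lmodule.on path_alg.

Definition pmon (p : qpath Q) : path_alg := fm_base k p.

Definition opmon (o : option (qpath Q)) : path_alg :=
  if o is Some p then pmon p else 0.

Definition pmul (f g : path_alg) : path_alg :=
  lext (fun p => lext (fun q => opmon (pconc p q)) g) f.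

Definition pone : path_alg := \sum_(i : vert Q) pmon (trivial_path i).

Lemma path_alg_ind (P : path_alg -> Prop) :
  P 0 -> (forall a p f, P f -> P (a *: pmon p + f)) -> forall f, P f.
Proof. exact: fm_ind. Qed.

Lemma pmulPl a f g h : pmul (a *: f + g) h = a *: pmul f h + pmul g h.
Proof. exact: lext_is_linear. Qed.

Lemma pmulPr a f g h : pmul h (a *: f + g) = a *: pmul h f + pmul h g.
Proof.
rewrite /pmul /lext scaler_sumr -big_split /=; apply: eq_bigr => p _.
by rewrite -/(lext _ (a *: f + g)) linearP scalerDr scalerA mulrC -scalerA.
Qed.

Lemma pmul0 f : pmul f 0 = 0.
Proof. by have := pmulPr (-1) 0 0 f; rewrite scaler0 addr0 scaleN1r addNr. Qed.

Lemma mul0p f : pmul 0 f = 0.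
Proof. by have := pmulPl (-1) 0 0 f; rewrite scaler0 addr0 scaleN1r addNr. Qed.

Lemma pmulE p q : pmul (pmon p) (pmon q) = opmon (pconc p q).
Proof. by rewrite /pmul /pmon !lextU. Qed.

Lemma pmulEr p o : pmul (pmon p) (opmon o) = opmon (obind (pconc p) o).
Proof. by case: o => [q|]; rewrite /= ?pmulE ?pmul0. Qed.

Lemma pmulEl p o : pmul (opmon o) (pmon p) = opmon (obind ((@pconc Q)^~ p) o).
Proof. by case: o => [q|]; rewrite /= ?pmulE ?mul0p. Qed.

Fact pmulA : associative pmul.
Proof.
elim/path_alg_ind => [|a p f IHf] g h; first by rewrite !mul0p.
rewrite (pmulPl a (pmon p) f (pmul g h)) (pmulPl a (pmon p) f g).
rewrite (pmulPl a (pmul (pmon p) g) (pmul f g) h) IHf.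
suff -> : pmul (pmon p) (pmul g h) = pmul (pmul (pmon p) g) h by [].
elim/path_alg_ind: g {IHf} => [|b q g IHg]; first by rewrite mul0p pmul0 mul0p.
rewrite (pmulPl b (pmon q) g h) (pmulPr b (pmon q) g (pmon p)).
rewrite (pmulPr b (pmul (pmon q) h) (pmul g h) (pmon p)).
rewrite (pmulPl b (pmul (pmon p) (pmon q)) (pmul (pmon p) g) h) IHg.
suff -> : pmul (pmon p) (pmul (pmon q) h) = pmul (pmul (pmon p) (pmon q)) h by [].
elim/path_alg_ind: h {IHg} => [|c r h IHh]; first by rewrite !pmul0.
rewrite (pmulPr c (pmon r) h (pmon q)) (pmulPr c (pmon r) h (pmul _ _)).
rewrite (pmulPr c (pmul (pmon q) (pmon r)) (pmul (pmon q) h) (pmon p)) IHh.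
suff -> : pmul (pmon p) (pmul (pmon q) (pmon r))
        = pmul (pmul (pmon p) (pmon q)) (pmon r) by [].
by rewrite !pmulE pmulEr pmulEl pconcA.
Qed.

Fact pmulDl : left_distributive pmul +%R.
Proof. by move=> f g h; have := pmulPl 1 f g h; rewrite !scale1r. Qed.

Fact pmulDr : right_distributive pmul +%R.
Proof. by move=> h f g; have := pmulPr 1 f g h; rewrite !scale1r. Qed.

Fact pmul1l : left_id pone pmul.
Proof.
elim/path_alg_ind => [|a p f IH]; first by rewrite pmul0.
rewrite pmulPr IH; suff -> : pmul pone (pmon p) = pmon p by [].
rewrite /pone (bigD1 (psrc p)) //= pmulDl pmulE pconc1p eqxx /= .
rewrite [X in pmul X _](_ : _ = \sum_(i | i != psrc p) 1 *: pmon (trivial_path i));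
  last by apply: eq_bigr => i _; rewrite scale1r.
elim/big_rec: _ => [|i x ni]; first by rewrite mul0p addr0.
by rewrite pmulPl pmulE pconc1p (negPf ni) /= scaler0 add0r.
Qed.

Fact pmul1r : right_id pone pmul.
Proof.
elim/path_alg_ind => [|a p f IH]; first by rewrite mul0p.
rewrite pmulPl IH; suff -> : pmul (pmon p) pone = pmon p by [].
rewrite /pone (bigD1 (ptgt p)) //= pmulDr pmulE pconcp1 eqxx /= .
rewrite [X in pmul _ X](_ : _ = \sum_(i | i != ptgt p) 1 *: pmon (trivial_path i));
  last by apply: eq_bigr => i _; rewrite scale1r.
elim/big_rec: _ => [|i x ni]; first by rewrite pmul0 addr0.
by rewrite pmulPr pmulE pconcp1 (negPf ni) /= scaler0 add0r.
Qed.

Fact pone_neq0 : pone != 0.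
Proof.
have [i _] := card_gt0P (vert_gt0 Q).
apply/eqP => /(congr1 (@lext k (qpath Q) k^o (fun p => (psrc p == i)%:R))).
rewrite [RHS]linear0 [LHS]linear_sum (bigD1 i) //=.
rewrite lextU /= eqxx big1 ?addr0 => [/eqP|j ji]; first by rewrite oner_eq0.
by rewrite lextU /= (negPf ji).
Qed.

HB.instance Definition _ := GRing.Zmodule_isNzRing.Build path_alg
  pmulA pmul1l pmul1r pmulDl pmulDr pone_neq0.

Fact path_alg_scaleAl (a : k) (f g : path_alg) : a *: (f * g) = a *: f * g.
Proof. by have := pmulPl a f 0 g; rewrite addr0 mul0p addr0. Qed.

HB.instance Definition _ :=
  GRing.Lmodule_isLalgebra.Build k path_alg path_alg_scaleAl.

Fact path_alg_scaleAr (a : k) (f g : path_alg) : a *: (f * g) = f * (a *: g).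
Proof. by have := pmulPr a g 0 f; rewrite addr0 pmul0 addr0. Qed.

HB.instance Definition _ :=
  GRing.Lalgebra_isAlgebra.Build k path_alg path_alg_scaleAr.

Definition idem (i : vert Q) : path_alg := pmon (trivial_path i).
Definition arrow (a : arr Q) : path_alg := pmon (arrow_path a).

End PathAlgebra.

Section Bimodules.
Variable A : nzRingType.

Record bimod := Bimod {
  bm_left :> lmodType A;
  bm_act : bm_left -> A -> bm_left;
  bm_actDl : forall a, {morph bm_act^~ a : x y / x + y};
  bm_actDr : forall x, {morph bm_act x : a b / a + b};
  bm_act1 : forall x, bm_act x 1 = x;
  bm_actA : forall x a b, bm_act x (a * b) = bm_act (bm_act x a) b;
  bm_actC : forall a x b, bm_act (a *: x) b = a *: bm_act x b
}.

Record bimod_hom (X Y : bimod) := BimodHom {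
  bm_map :> {linear X -> Y};
  bm_mapr : forall x a, bm_map (bm_act x a) = bm_act (bm_map x) a
}.

Definition regular_bimod : bimod.
Proof.
refine (@Bimod A^o (fun x a => x * a) _ _ _ _ _).
- by move=> a x y; exact: mulrDl.
- by move=> x a b; exact: mulrDr.
- exact: mulr1.
- exact: mulrA.
- by move=> a x b; rewrite -[LHS]mulrA.
Defined.

Section Tensor.
Variables (X : bimod) (M : lmodType A).

Local Notation pair x m := (fm_base A ((x, m) : (X * M)%type)).

(* X (x)_A M with its left A-module structure is presented as a left A-module:
   the last relation identifies the formal multiples a (x, m) with (a x, m) *)
Inductive tens_rel : fmod A (X * M)%type -> Prop :=
| tens_relDl x y m : tens_rel (pair (x + y) m - pair x m - pair y m)
| tens_relDr x m n : tens_rel (pair x (m + n) - pair x m - pair x n)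
| tens_relA x a m : tens_rel (pair (bm_act x a) m - pair x (a *: m))
| tens_relZ a x m : tens_rel (pair (a *: x) m - a *: pair x m).

Definition tens : lmodType A := lquot tens_rel.

Definition tmk (x : X) (m : M) : tens := lq_pi tens_rel (pair x m).

Lemma tmkDl x y m : tmk (x + y) m = tmk x m + tmk y m.
Proof.
apply/eqP; rewrite -linearD lq_pi_eq opprD addrA span_sub //.
exact: tens_relDl.
Qed.

Lemma tmkDr x m n : tmk x (m + n) = tmk x m + tmk x n.
Proof.
apply/eqP; rewrite -linearD lq_pi_eq opprD addrA span_sub //.
exact: tens_relDr.
Qed.

Lemma tmkA x a m : tmk (bm_act x a) m = tmk x (a *: m).
Proof. by apply/eqP; rewrite lq_pi_eq span_sub //; exact: tens_relA. Qed.

Lemma tmkZ a x m : tmk (a *: x) m = a *: tmk x m.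
Proof.
apply/eqP; rewrite -linearZ lq_pi_eq span_sub //; exact: tens_relZ.
Qed.

End Tensor.

Section TensorMap.
Variables (X Y : bimod) (f : bimod_hom X Y) (M : lmodType A).

Fact tens_map_subproof s : tens_rel s ->
  @lext A (X * M)%type (tens Y M) (fun xm => tmk (f xm.1) xm.2) s = 0.
Proof.
case=> [x y m|x m n|x a m|a x m]; rewrite !linearB ?linearZ /= !lextU /=.
- by rewrite linearD tmkDl addrAC addrK subrr.
- by rewrite tmkDr addrAC addrK subrr.
- by rewrite bm_mapr tmkA subrr.
- by rewrite linearZ /= tmkZ scalerN subrr.
Qed.

Definition tens_map : {linear tens X M -> tens Y M} :=
  lq_map tens_map_subproof.

Lemma tens_mapE x m : tens_map (tmk x m) = tmk (f x) m.
Proof. exact: etrans (lq_mapE (@tens_map_subproof) _) (lextU _ _). Qed.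

End TensorMap.

Section Unitor.
Variable M : lmodType A.

Definition unitor (m : M) : tens regular_bimod M :=
  tmk (1 : regular_bimod) m.

Fact unitor_is_linear : linear unitor.
Proof.
move=> a m n; rewrite /unitor tmkDr -tmkA -tmkZ.
by congr (tmk _ _ + _); rewrite /= mul1r -[RHS]/(a * 1) mulr1.
Qed.

HB.instance Definition _ :=
  GRing.isLinear.Build A M (tens regular_bimod M) _ unitor unitor_is_linear.

End Unitor.

End Bimodules.

Section DoubleQuiver.
Variables (k : fieldType) (Q : quiver).

(* inl a is the arrow a of Q, inr a is its reverse *)
Definition double : quiver := @Quiver (vert Q) (arr Q + arr Q)%type
  (fun a => match a with inl b => tail b | inr b => head b end)
  (fun a => match a with inl b => head b | inr b => tail b end)
  (vert_gt0 Q).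

Fact double_walk i (s : seq (arr Q)) :
  walk i s -> @walk double i (map inl s).
Proof. by elim: s i => //= a s IH i /andP[-> /IH]. Qed.

Definition double_path (p : qpath Q) : qpath double :=
  @QPath double (psrc p, map inl (parr p)) (double_walk (qpath_walk p)).

Lemma double_path_tgt p : ptgt (double_path p) = ptgt p.
Proof. by rewrite /ptgt /walk_end -map_comp. Qed.

Lemma double_pconc p q :
  pconc (double_path p) (double_path q) = omap double_path (pconc p q).
Proof.
have [pq|npq] := eqVneq (ptgt p) (psrc q); last first.
  by rewrite !pconc_none // double_path_tgt.
have [|x -> xE] := @pconc_some _ (double_path p) (double_path q).
  by rewrite double_path_tgt.
have [y -> yE] := pconc_some pq; congr Some; apply: val_inj; rewrite xE /=.
by rewrite /psrc /parr yE /= map_cat.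
Qed.

Definition double_incl : path_alg k Q -> path_alg k double :=
  lext (fun p => pmon k (double_path p)).

HB.instance Definition _ := GRing.Linear.on double_incl.

Lemma double_inclE p : double_incl (pmon k p) = pmon k (double_path p).
Proof. exact: lextU. Qed.

Fact double_incl_is_monoid_morphism : monoid_morphism double_incl.
Proof.
split.
  rewrite linear_sum; apply: eq_bigr => i _ /=; rewrite double_inclE.
  by congr (pmon k _); exact: val_inj.
elim/path_alg_ind => [|a p f IH] g; first by rewrite mul0r linear0 mul0r.
rewrite mulrDl -scalerAl !linearP /= mulrDl -scalerAl IH.
suff -> : double_incl (pmon k p * g) = double_incl (pmon k p) * double_incl g.
  by [].
elim/path_alg_ind: g {IH} => [|b q g IH]; first by rewrite mulr0 linear0 mulr0.
rewrite mulrDr -scalerAr !linearP /= mulrDr -scalerAr IH.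
suff -> : double_incl (pmon k p * pmon k q)
        = double_incl (pmon k p) * double_incl (pmon k q) by [].
rewrite !double_inclE [pmon k p * _]pmulE [RHS]pmulE double_pconc.
by case: (pconc p q) => [r|] /=; rewrite ?double_inclE ?linear0.
Qed.

HB.instance Definition _ := GRing.isMonoidMorphism.Build _ _ double_incl
  double_incl_is_monoid_morphism.

Local Notation dalg := (path_alg k double).

(* deg^* of a path: the number of reversed arrows *)
Definition pdeg (p : qpath double) : nat :=
  count (fun a => if a is inr _ then true else false) (parr p).

Definition homog (n : nat) : {pred dalg} :=
  span (fun x => exists2 p, pdeg p = n & x = pmon k p).

HB.instance Definition _ n := GRing.SubmodClosed.on (homog n).

Lemma homog_pmon p : pmon k p \in homog (pdeg p).
Proof. by apply: span_sub; exists p. Qed.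

Lemma homog_ind n (P : dalg -> Prop) : P 0 ->
  (forall a p f, pdeg p = n -> P f -> P (a *: pmon k p + f)) ->
  forall f, f \in homog n -> P f.
Proof.
move=> P0 PD f /asboolP.
pose T : {pred dalg} := fun x =>
  `[< forall c y, P y -> P (c *: x + y) >].
move=> /(_ T) Tf; have /asboolP : f \in T; last first.
  by move=> /(_ 1 0 P0); rewrite scale1r addr0.
apply: Tf => [|x [p pn ->]]; last by apply/asboolP => c y; exact: PD.
split=> [|a x y /asboolP Tx /asboolP Ty]; apply/asboolP => c z Pz.
  by rewrite scaler0 add0r.
by rewrite scalerDr scalerA -addrA; apply: Tx; exact: Ty.
Qed.

Lemma pdeg_pconc p q r : pconc p q = Some r -> pdeg r = (pdeg p + pdeg q)%N.
Proof.
have [pq|/pconc_none -> //] := eqVneq (ptgt p) (psrc q).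
by have [x -> xE] := pconc_some pq => -[<-]; rewrite /pdeg {1}/parr xE count_cat.
Qed.

Lemma homogM m n x y :
  x \in homog m -> y \in homog n -> x * y \in homog (m + n).
Proof.
move=> hx hy; elim/homog_ind: hx => [|a p f <- hf]; first by rewrite mul0r rpred0.
rewrite mulrDl -scalerAl rpredD // rpredZ //.
elim/homog_ind: hy {hf} => [|b q g <- hg]; first by rewrite mulr0 rpred0.
rewrite mulrDr -scalerAr rpredD // rpredZ // [_ * _]pmulE.
case pq: (pconc p q) => [r|] /=; last by rewrite rpred0.
by rewrite -(pdeg_pconc pq) homog_pmon.
Qed.

Lemma homog_incl f : double_incl f \in homog 0.
Proof.
elim/path_alg_ind: f => [|a p f IH]; first by rewrite linear0 rpred0.
rewrite linearP /= rpredD // rpredZ // double_inclE.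
have <- : pdeg (double_path p) = 0%N by rewrite /pdeg /= count_map; elim: (parr p).
exact: homog_pmon.
Qed.

Section Piece.
Variables (S : dalg -> Prop) (n : nat).

(* The degree n part of the quotient of k(double Q) by the ideal generated by
   S, as an A-bimodule. It is a graded part when S consists of homogeneous
   elements. *)
Definition piece_pred : {pred rquot S} := fun x =>
  `[< exists2 y, y \in homog n & x = rq_pi S y >].

Lemma piece_zmod_closed : zmod_closed piece_pred.
Proof.
split=> [|x y /asboolP[x' hx ->] /asboolP[y' hy ->]]; apply/asboolP.
  by exists 0; rewrite ?rpred0 ?raddf0.
by exists (x' - y'); rewrite ?rpredB ?raddfB.
Qed.

HB.instance Definition _ :=
  GRing.isZmodClosed.Build (rquot S) piece_pred piece_zmod_closed.

Lemma pieceM a x b : x \in piece_pred ->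
  rq_pi S (double_incl a) * x * rq_pi S (double_incl b) \in piece_pred.
Proof.
move=> /asboolP[y hy ->]; apply/asboolP.
exists (double_incl a * y * double_incl b); last by rewrite !rmorphM.
by have := homogM (homogM (homog_incl a) hy) (homog_incl b); rewrite add0n addn0.
Qed.

Record piece := Piece { piece_val : rquot S; piece_valP : piece_val \in piece_pred }.

HB.instance Definition _ := [isSub for piece_val].
HB.instance Definition _ := [Choice of piece by <:].
HB.instance Definition _ := [SubChoice_isSubZmodule of piece by <:].

Fact piece_lact_subproof (a : path_alg k Q) (x : piece) :
  rq_pi S (double_incl a) * val x \in piece_pred.
Proof. by have := pieceM a 1 (valP x); rewrite !rmorph1 mulr1. Qed.

Fact piece_ract_subproof (x : piece) (a : path_alg k Q) :
  val x * rq_pi S (double_incl a) \in piece_pred.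
Proof. by have := pieceM 1 a (valP x); rewrite !rmorph1 mul1r. Qed.

Definition piece_lact (a : path_alg k Q) (x : piece) : piece :=
  Piece (piece_lact_subproof a x).

Definition piece_ract (x : piece) (a : path_alg k Q) : piece :=
  Piece (piece_ract_subproof x a).

Fact piece_lactA a b x :
  piece_lact a (piece_lact b x) = piece_lact (a * b) x.
Proof. by apply: val_inj; rewrite /= !rmorphM mulrA. Qed.
Fact piece_lact1 : left_id 1 piece_lact.
Proof. by move=> x; apply: val_inj; rewrite /= !rmorph1 mul1r. Qed.
Fact piece_lactDr : right_distributive piece_lact +%R.
Proof. by move=> a x y; apply: val_inj; rewrite /= mulrDr. Qed.
Fact piece_lactDl x : {morph piece_lact^~ x : a b / a + b}.
Proof. by move=> a b; apply: val_inj; rewrite /= !rmorphD mulrDl. Qed.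

HB.instance Definition _ := GRing.Zmodule_isLmodule.Build (path_alg k Q) piece
  piece_lactA piece_lact1 piece_lactDr piece_lactDl.

Definition piece_bimod : bimod (path_alg k Q).
Proof.
refine (@Bimod (path_alg k Q) piece piece_ract _ _ _ _ _).
- by move=> a x y; apply: val_inj; rewrite /= mulrDl.
- by move=> x a b; apply: val_inj; rewrite /= !rmorphD mulrDr.
- by move=> x; apply: val_inj; rewrite /= !rmorph1 mulr1.
- by move=> x a b; apply: val_inj; rewrite /= !rmorphM mulrA.
- by move=> a x b; apply: val_inj; rewrite /= mulrA.
Defined.

End Piece.

Definition rho (i : vert Q) : dalg :=
    \sum_(a : arr Q | tail a == i)
       arrow k (inl a : arr double) * arrow k (inr a : arr double)
  - \sum_(a : arr Q | head a == i)
       arrow k (inr a : arr double) * arrow k (inl a : arr double).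

(* Meaningful for sincere weights only, as 0^-1 = 0 *)
Definition wrho (v : vert Q -> k) : dalg := \sum_i (v i)^-1 *: rho i.

Definition weta (v : vert Q -> k) (a : arr double) : dalg :=
  arrow k a * wrho v - wrho v * arrow k a.

Definition preproj_rel (x : dalg) : Prop := exists i, x = rho i.
Definition heisenberg_rel (v : vert Q -> k) (x : dalg) : Prop :=
  exists a, x = weta v a.

Definition preprojective := rquot preproj_rel.
Definition heisenberg (v : vert Q -> k) := rquot (heisenberg_rel v).

Definition preprojective_deg (n : nat) : bimod (path_alg k Q) :=
  piece_bimod preproj_rel n.
Definition heisenberg_deg (v : vert Q -> k) (n : nat) : bimod (path_alg k Q) :=
  piece_bimod (heisenberg_rel v) n.

Variable v : vert Q -> k.

Lemma rho_homog i : rho i \in homog 1.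
Proof.
have hl a : arrow k (inl a : arr double) \in homog 0 by exact: homog_pmon.
have hr a : arrow k (inr a : arr double) \in homog 1 by exact: homog_pmon.
rewrite rpredB // rpred_sum // => a _.
  exact: homogM (hl a) (hr a).
exact: homogM (hr a) (hl a).
Qed.

Lemma wrho_homog : wrho v \in homog 1.
Proof. by rewrite rpred_sum // => i _; rewrite rpredZ // rho_homog. Qed.

Lemma idemM i (a : arr double) (x : dalg) :
  idem k i * (arrow k a * x) = if i == tail a then arrow k a * x else 0.
Proof.
rewrite mulrA [idem k i * _]pmulE pconc1p.
by case: ifP => _ //=; rewrite mul0r.
Qed.

Lemma Midem i (a : arr double) (x : dalg) :
  x * arrow k a * idem k i = if i == head a then x * arrow k a else 0.
Proof.
rewrite -mulrA [arrow k a * _]pmulE pconcp1.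
by case: ifP => _ //=; rewrite mulr0.
Qed.

Lemma idem_rho (i j : vert Q) :
  idem k (i : vert double) * rho j = if i == j then rho j else 0.
Proof.
rewrite mulrBr !mulr_sumr; case: eqVneq => [->|ij].
  by congr (_ - _); apply: eq_bigr => a /eqP ja; rewrite idemM /= ja eqxx.
by rewrite !big1 ?subr0 // => a /eqP ja; rewrite idemM /= ja (negPf ij).
Qed.

Lemma rho_idem (i j : vert Q) :
  rho j * idem k (i : vert double) = if i == j then rho j else 0.
Proof.
rewrite mulrBl !mulr_suml; case: eqVneq => [->|ij].
  by congr (_ - _); apply: eq_bigr => a /eqP ja; rewrite Midem /= ja eqxx.
by rewrite !big1 ?subr0 // => a /eqP ja; rewrite Midem /= ja (negPf ij).
Qed.

Lemma idem_wrho i : idem k (i : vert double) * wrho v = wrho v * idem k i.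
Proof.
rewrite mulr_sumr mulr_suml; apply: eq_bigr => j _.
by rewrite -scalerAr -scalerAl idem_rho rho_idem.
Qed.

Lemma pmon_cons i a s (w : @walk double i (a :: s)) (w' : walk (head a) s) :
  pmon k (@QPath double (i, a :: s) w) =
  arrow k a * pmon k (@QPath double (head a, s) w').
Proof.
rewrite [RHS]pmulE.
have [|x -> xE] := @pconc_some _ (arrow_path a) (@QPath double (head a, s) w').
  by [].
congr (pmon k _); apply: val_inj; rewrite xE /=.
by case/andP: (w) => /eqP <-.
Qed.

Lemma wrho_central x :
  rq_pi (heisenberg_rel v) x * rq_pi (heisenberg_rel v) (wrho v) =
  rq_pi (heisenberg_rel v) (wrho v) * rq_pi (heisenberg_rel v) x.
Proof.
pose comm y := rq_pi (heisenberg_rel v) (y * wrho v) =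
               rq_pi (heisenberg_rel v) (wrho v * y).
suff : comm x by rewrite /comm !rmorphM.
have commA a : comm (arrow k a).
  by apply/eqP; rewrite rq_pi_eq ideal_sub //; exists a.
have commM y z : comm y -> comm z -> comm (y * z).
  rewrite /comm !rmorphM /= => cy cz.
  by rewrite -mulrA cz mulrA cy -mulrA.
have commP p : comm (pmon k p).
  case: p => -[i s]; elim: s i => [|a s IH] i w.
    rewrite (_ : QPath w = trivial_path (i : vert double)); last exact: val_inj.
    by rewrite /comm idem_wrho.
  have /andP[_ w'] := w.
  by rewrite (pmon_cons w w'); apply: commM => //; exact: IH.
elim/path_alg_ind: x => [|c p f IH]; first by rewrite /comm mul0r mulr0.
rewrite /comm mulrDl mulrDr -scalerAl -scalerAr !rmorphD /= IH.
suff -> : rq_pi (heisenberg_rel v) (c *: (pmon k p * wrho v))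
        = rq_pi (heisenberg_rel v) (c *: (wrho v * pmon k p)) by [].
have e (y : dalg) : c *: y = (c *: 1) * y by rewrite -scalerAl mul1r.
rewrite (e (pmon k p * wrho v)) (e (wrho v * pmon k p)).
rewrite [LHS](rmorphM _ (c *: 1)) [RHS](rmorphM _ (c *: 1)) /=.
by rewrite (commP p).
Qed.

Fact wrho_piece_subproof : rq_pi (heisenberg_rel v) (wrho v) \in
  piece_pred 1.
Proof. by apply/asboolP; exists (wrho v); rewrite ?wrho_homog. Qed.

Definition wrho1 : heisenberg_deg v 1 := Piece wrho_piece_subproof.

Definition wrho_map (x : regular_bimod (path_alg k Q)) : heisenberg_deg v 1 :=
  (x : path_alg k Q) *: wrho1.

Fact wrho_map_is_linear : linear wrho_map.
Proof. by move=> a x y; rewrite /wrho_map scalerDl scalerA. Qed.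

HB.instance Definition _ := GRing.isLinear.Build (path_alg k Q)
  (regular_bimod (path_alg k Q)) (heisenberg_deg v 1) _ wrho_map
  wrho_map_is_linear.

Fact wrho_mapr x a : wrho_map (bm_act x a) = bm_act (wrho_map x) a.
Proof. by apply: val_inj; rewrite /= !rmorphM -!mulrA wrho_central. Qed.

Definition wrho_hom :
    bimod_hom (regular_bimod (path_alg k Q)) (heisenberg_deg v 1) :=
  @BimodHom _ (regular_bimod _) (heisenberg_deg v 1) wrho_map wrho_mapr.

Lemma heisenberg_preproj x :
  x \in ideal (heisenberg_rel v) -> x \in ideal preproj_rel.
Proof.
move=> /asboolP h; apply: h => [|a y b yI|_ [a ->]].
- exact: ideal_zmod_closed.
- exact: idealM.
have hw : wrho v \in ideal preproj_rel.
  rewrite rpred_sum // => i _.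
  rewrite -[_ *: _]mulr1 -[rho i]mul1r scalerAl.
  by apply: idealM; apply: ideal_sub; exists i.
rewrite rpredB //.
  by rewrite -[_ * _]mulr1; exact: idealM.
by rewrite -[X in X * _]mul1r; exact: idealM.
Qed.

Definition heis_proj (x : heisenberg v) : preprojective :=
  rq_pi preproj_rel (repr x).

Lemma heis_projE x :
  heis_proj (rq_pi (heisenberg_rel v) x) = rq_pi preproj_rel x.
Proof.
by apply/eqP; rewrite rq_pi_eq heisenberg_preproj // -rq_pi_eq rq_reprK.
Qed.

Lemma heis_projB : {morph heis_proj : x y / x - y}.
Proof.
by elim/rq_ind => x; elim/rq_ind => y; rewrite -raddfB !heis_projE raddfB.
Qed.

Lemma heis_projD : {morph heis_proj : x y / x + y}.
Proof.
by elim/rq_ind => x; elim/rq_ind => y; rewrite -raddfD !heis_projE raddfD.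
Qed.

Lemma heis_projM : {morph heis_proj : x y / x * y}.
Proof.
by elim/rq_ind => x; elim/rq_ind => y; rewrite -rmorphM !heis_projE rmorphM.
Qed.

Fact heis_proj_piece n (x : heisenberg_deg v n) :
  heis_proj (val x) \in piece_pred n.
Proof.
have /asboolP[y hy ->] := valP x.
by rewrite heis_projE; apply/asboolP; exists y.
Qed.

Definition heis_proj_deg n (x : heisenberg_deg v n) : preprojective_deg n :=
  Piece (heis_proj_piece x).

Fact heis_proj_deg_is_linear n : linear (@heis_proj_deg n).
Proof.
by move=> a x y; apply: val_inj; rewrite /= heis_projD heis_projM heis_projE.
Qed.

HB.instance Definition _ n := GRing.isLinear.Build (path_alg k Q)
  (heisenberg_deg v n) (preprojective_deg n) _ (@heis_proj_deg n)
  (@heis_proj_deg_is_linear n).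

Fact heis_proj_degr n x a :
  @heis_proj_deg n (bm_act x a) = bm_act (heis_proj_deg x) a.
Proof. by apply: val_inj; rewrite /= heis_projM heis_projE. Qed.

Definition heis_proj_hom n :
    bimod_hom (heisenberg_deg v n) (preprojective_deg n) :=
  @BimodHom _ (heisenberg_deg v n) (preprojective_deg n) (@heis_proj_deg n)
    (@heis_proj_degr n).

End DoubleQuiver.

Section FiniteDimensionalModules.
Variables (k : fieldType) (A : algType k).

Definition fin_dim (M : lmodType A) : Prop :=
  exists s : seq M, forall m : M, exists c : 'I_(size s) -> k,
    m = \sum_(i < size s) (c i)%:A *: s`_i.

(* d is the k-dimension of the subspace U *)
Definition is_kdim (M : lmodType A) (U : M -> Prop) (d : nat) : Prop :=
  exists b : 'I_d -> M, (forall i, U (b i)) /\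
    (forall m, U m -> exists! c : {ffun 'I_d -> k},
       m = \sum_(i < d) (c i)%:A *: b i).

Definition indecomposable (M : lmodType A) : Prop :=
  (exists m : M, m != 0) /\
  (forall (X Y : lmodType A) (f : {linear M -> (X * Y)%type}), bijective f ->
     (forall x : X, x = 0) \/ (forall y : Y, y = 0)).

Definition injective_module (I : lmodType A) : Prop :=
  forall (X Y : lmodType A), fin_dim X -> fin_dim Y ->
  forall f : {linear X -> Y}, injective f ->
  forall g : {linear X -> I}, exists h : {linear Y -> I}, forall x, h (f x) = g x.

Definition split_mono (M E : lmodType A) (f : {linear M -> E}) : Prop :=
  exists r : {linear E -> M}, forall m, r (f m) = m.

Definition split_epi (E N : lmodType A) (g : {linear E -> N}) : Prop :=
  exists s : {linear N -> E}, forall n, g (s n) = n.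

Definition left_almost_split (M E : lmodType A) (f : {linear M -> E}) : Prop :=
  ~ split_mono f /\
  (forall X : lmodType A, fin_dim X ->
   forall u : {linear M -> X}, ~ split_mono u ->
   exists w : {linear E -> X}, forall m, w (f m) = u m).

Definition right_almost_split (E N : lmodType A) (g : {linear E -> N}) : Prop :=
  ~ split_epi g /\
  (forall X : lmodType A, fin_dim X ->
   forall u : {linear X -> N}, ~ split_epi u ->
   exists w : {linear X -> E}, forall x, g (w x) = u x).

Definition short_exact (M E N : lmodType A)
    (f : {linear M -> E}) (g : {linear E -> N}) : Prop :=
  [/\ injective f, (forall n, exists e, g e = n)
    & forall e, g e = 0 <-> exists m, f m = e].

(* Auslander-Reiten (almost split) sequence 0 -> M -> E -> N -> 0 of
   finite-dimensional modules *)
Definition AR_sequence (M E N : lmodType A)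
    (f : {linear M -> E}) (g : {linear E -> N}) : Prop :=
  [/\ fin_dim M, fin_dim E & fin_dim N] /\
  [/\ short_exact f g, left_almost_split f & right_almost_split g].

End FiniteDimensionalModules.

Section Weights.
Variables (k : fieldType) (Q : quiver) (v : vert Q -> k).

Definition regular_weight : Prop :=
  forall N : lmodType (path_alg k Q), fin_dim N -> indecomposable N ->
  forall d : vert Q -> nat,
    (forall i, is_kdim (fun x : N => exists y, x = idem k i *: y) (d i)) ->
  \sum_i v i * (d i)%:R != 0.

Variable M : lmodType (path_alg k Q).

(* M = A (x)_A M -> Lambda_1 (x)_A M *)
Definition wrho_mod : {linear M -> tens (heisenberg_deg v 1) M} :=
  tens_map (wrho_hom v) M \o @unitor _ M.

Definition proj_mod :
    {linear tens (heisenberg_deg v 1) M -> tens (preprojective_deg k Q 1) M} :=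
  tens_map (heis_proj_hom v 1) M.

End Weights.

(* Main.v *)
(* Write E for Lambda_1 (x) M and N for Pi_1 (x) M; an arrow a acts as a map
   M_h -> M_t. A morphism E -> X is a family of linear maps phi_a : M_t -> X_h
   such that v^-1 delta(phi) is a morphism M -> X, where
     delta(phi) = sum_a (a phi_a - phi_a a) in (+)_i Hom(M_i, X_i);
   this morphism is its composite with wrho : M -> E. For N one requires
   delta(phi) = 0. Hence u : M -> X extends along wrho if and only if v u lies
   in the image of delta. Under the trace pairing the kernel of the transpose of
   delta is Hom_A(X, M), so the condition reads
     sum_i v_i tr(psi_i u_i) = 0 for every psi : X -> M.
   When u is not a split monomorphism every psi u is nilpotent by Fitting's
   lemma, so the condition holds, whereas for u = id and psi = id the sum is
   sum_i v_i dim M_i, which is nonzero. Thus wrho is left almost split; it is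
   injective because a non-injective M has a non-split embedding in some X.

   For the right-hand side let eps be the class of the sequence in Ext^1(N, M).
   Left almost splitness says that every nonzero class c in Ext^1(X, M)
   satisfies s^* c = eps for some s : N -> X. If u : X -> N does not lift to E,
   then u^* eps is nonzero, so kappa^* eps = eps for some kappa = u s. If the
   identity of N were not of the form t kappa, some c in Ext^1(N, M) would pair
   to zero with all the t kappa but not with the identity; choosing t with
   t^* c = eps gives 0 = <c, t kappa> = <eps, id> = sum_i v_i dim M_i, a
   contradiction. So kappa is bijective and u is a split epimorphism. *)

From HB Require Import structures.
From mathcomp Require Import all_boot all_order all_algebra.
From mathcomp Require Import boolp.
Require Import Defs.

Set Implicit Arguments.
Unset Strict Implicit.
Unset Printing Implicit Defensive.

Import GRing.Theory.
Local Open Scope ring_scope.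

(** * Linear algebra *)

Section LinearAlgebra.
Variable k : fieldType.

(** By induction on the size, which works over any field. If B = CD is a full rank factorization of
    a singular B, then tr B = tr(DC), where DC is smaller and nilpotent since (DC)^(m+1) = D B^m C.
    An invertible B is nilpotent only in size 0. *)
Lemma mxtrace_nilpotent n m (B : 'M[k]_n) : B ^+ m = 0 -> \tr B = 0.
Proof.
elim/ltn_ind: n m B => n IH m B Bm.
have [rn|rn] := ltnP (\rank B) n; last first.
  have uB : B \in unitmx.
    by rewrite -row_free_unit /row_free eqn_leq rank_leq_row.
  have : B ^+ m \in unitmx.
    by elim: (m) => [|i IHi]; rewrite ?expr0 ?unitmx1 // exprS unitmx_mul uB.
  rewrite Bm; case: n {IH rn uB Bm m} B => [|n] B.
    by rewrite /mxtrace big_ord0.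
  by rewrite -row_free_unit /row_free mxrank0.
have powE r (C : 'M_(n, r)) (D : 'M_(r, n)) i :
    C *m D = B -> (D *m C) ^+ i.+1 = D *m B ^+ i *m C.
  move=> CD; elim: i => [|i IHi]; first by rewrite expr1 expr0 mulmx1.
  rewrite exprS IHi [B ^+ i.+1]exprS -[_ * (_ *m _)]/(_ *m (_ *m _)).
  by rewrite -[B * _]/(_ *m _) -CD !mulmxA.
rewrite -(mulmx_base B) mxtrace_mulC; apply: (IH _ rn m.+1).
by rewrite powE ?mulmx_base // Bm mulmx0 mul0mx.
Qed.

(** For a full rank factorization B = CD, idempotence can be cancelled on both sides to give DC = 1,
    an identity matrix whose size is the rank. *)
Lemma mxtrace_idempotent n (B : 'M[k]_n) : B *m B = B -> \tr B = (\rank B)%:R.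
Proof.
move=> BB; have Bcr := mulmx_base B.
rewrite -{1}Bcr mxtrace_mulC; suff -> : row_base B *m col_base B = 1%:M.
  by rewrite mxtrace1.
have rf := row_base_free B; have cf := col_base_full B.
apply: (row_free_inj rf); apply: (row_full_inj cf).
move: Bcr; move: (col_base B) (row_base B) => C D CD.
by rewrite mul1mx CD -(mulmxA D) CD mulmxA CD BB.
Qed.

Section Annihilator.
Variables (V : vectType k) (K : {pred V}).
Hypothesis Kc : GRing.submod_closed K.

(** Take a subspace of maximal dimension inside K: adjoining a further vector of K cannot enlarge
    it. *)
Lemma submod_vspace : exists U : {vspace V}, forall x, (x \in K) = (x \in U).
Proof.
have KD x y : x \in K -> y \in K -> x + y \in K.
  by move=> Kx Ky; rewrite -[x]scale1r Kc.2.
have KZ a x : x \in K -> a *: x \in K.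
  by move=> Kx; rewrite -[_ *: _]addr0 Kc.2 ?Kc.1.
pose P d := `[< exists2 U : {vspace V}, \dim U = d & {subset U <= K} >].
have P0 : exists d, P d.
  exists 0; apply/asboolP; exists 0%VS; first by rewrite dimv0.
  by move=> x; rewrite memv0 => /eqP ->; rewrite Kc.1.
have Pb d : P d -> (d <= \dim {:V})%N.
  by move=> /asboolP[U <- _]; rewrite dimvS ?subvf.
case: (ex_maxnP P0 Pb) => d /asboolP[U dU UK] dmax.
exists U => x; apply/idP/idP => [Kx|]; last exact: UK.
have /dmax : P (\dim (U + <[x]>)).
  apply/asboolP; exists (U + <[x]>)%VS => // y /memv_addP[u /UK Ku [w]].
  by case/vlineP=> c -> ->; rewrite KD ?KZ.
rewrite -dU => dle; have sUx := addvSl U <[x]>.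
have /eqP -> : U == (U + <[x]>)%VS by rewrite eqEdim sUx.
by rewrite (subvP (addvSr U _)) // memv_line.
Qed.

Lemma submod_separate w : w \notin K ->
  exists l : {linear V -> k^o}, (forall z, z \in K -> l z = 0) /\ l w != 0.
Proof.
have [U KU] := submod_vspace; rewrite KU => wU.
pose w' := w - projv U w.
have w'0 : w' != 0.
  apply: contraNneq wU => /eqP; rewrite subr_eq0 => /eqP ->.
  exact: memv_proj.
have : exists i, coord (vbasis {:V}) i w' != 0.
  apply/existsP; apply: contraNT w'0 => /existsPn h.
  rewrite (coord_vbasis (memvf w')) big1 // => i _.
  by move: (h i); rewrite negbK => /eqP ->; rewrite scale0r.
case=> i wi.
pose l z : k^o := coord (vbasis {:V}) i (z - projv U z).
have ll : linear l.
  by move=> a x y; rewrite /l linearP opprD addrACA -scalerBr linearP.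
pose L : {linear V -> k^o} := HB.pack l (GRing.isLinear.Build k V k^o _ l ll).
exists L; split=> // z; rewrite KU => zU.
by rewrite /L /= /l projv_id // subrr linear0.
Qed.

End Annihilator.

(** The trace pairing of matrices is perfect; psi collects the values of l on the elementary
    matrices, transposed. *)
Lemma mx_functional m n (l : 'M[k]_(m, n) -> k) :
  (forall a x y, l (a *: x + y) = a * l x + l y) ->
  exists psi : 'M[k]_(n, m), forall z, l z = \tr (z *m psi).
Proof.
move=> ll.
have ll' : linear (l : _ -> k^o) by [].
pose L : {linear 'M[k]_(m, n) -> k^o} :=
  HB.pack (l : _ -> k^o) (GRing.isLinear.Build k _ k^o _ (l : _ -> k^o) ll').
exists (\matrix_(j, i) l (delta_mx i j)) => z.
rewrite -[LHS]/(L z) {1}[z]matrix_sum_delta !linear_sum.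
apply: eq_bigr => i _; rewrite mxE linear_sum; apply: eq_bigr => j _.
by rewrite linearZ /= mxE.
Qed.

Lemma ffmx_separate (I : finType) m n (K : {pred {ffun I -> 'M[k]_(m, n)}}) w :
  GRing.submod_closed K -> w \notin K ->
  exists psi : I -> 'M[k]_(n, m),
    (forall z : {ffun I -> 'M[k]_(m, n)},
       z \in K -> \sum_i \tr (z i *m psi i) = 0) /\
    \sum_i \tr (w i *m psi i) != 0.
Proof.
move=> Kc wK; have [l [lK lw]] := submod_separate Kc wK.
pose d i x : {ffun I -> 'M[k]_(m, n)} := [ffun j => if j == i then x else 0].
have dl i a x y : d i (a *: x + y) = a *: d i x + d i y.
  by apply/ffunP => j; rewrite !ffunE; case: ifP; rewrite ?scaler0 ?addr0.
have lP i : exists psi : 'M[k]_(n, m), forall z, l (d i z) = \tr (z *m psi).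
  by apply: mx_functional => a x y; rewrite dl linearP.
have [psi psiE] := choice lP.
have lE z : l z = \sum_i \tr (z i *m psi i).
  have {1}-> : z = \sum_i d i (z i).
    apply/ffunP => j; rewrite sum_ffunE (bigD1 j) //= ffunE eqxx.
    by rewrite big1 ?addr0 // => i /negPf ij; rewrite ffunE eq_sym ij.
  by rewrite linear_sum; apply: eq_bigr => i _; rewrite psiE.
by exists psi; split=> [z /lK|]; rewrite -lE.
Qed.

End LinearAlgebra.

(** * Bases and traces for modules over an algebra *)

Lemma linear_pack (R : pzRingType) (V W : lmodType R) (f : V -> W) :
  linear f -> exists g : {linear V -> W}, g =1 f.
Proof.
move=> fl.
pose g : {linear V -> W} := HB.pack f (GRing.isLinear.Build R V W _ f fl).
by exists g.
Qed.

Section LinearMaps.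
Variables (R : pzRingType) (V W : lmodType R).

Lemma bijective_inj_surj (T U : Type) (f : T -> U) :
  injective f -> (forall y, exists x, f x = y) -> bijective f.
Proof.
by move=> fi /choice[g gK]; exists g => // x; apply: fi; rewrite gK.
Qed.

Lemma bij_linear_inv (f : {linear V -> W}) : bijective f ->
  exists g : {linear W -> V}, cancel f g /\ cancel g f.
Proof.
case=> g fK gK; have gl : linear g.
  by move=> a x y; apply: (can_inj fK); rewrite linearP !gK.
by have [h hE] := linear_pack gl; exists h; split=> x; rewrite hE.
Qed.

Lemma span_id (S : V -> Prop) : S 0 ->
  (forall a x y, S x -> S y -> S (a *: x + y)) ->
  forall x, x \in span S -> S x.
Proof.
move=> S0 SP x /asboolP /(_ (fun y => `[< S y >])) h.
apply/asboolP; apply: h => [|s /asboolP //].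
by split=> [|a y z /asboolP Sy /asboolP Sz]; apply/asboolP; [|apply: SP].
Qed.

Lemma lq_pi_eq0 (S : V -> Prop) x : (lq_pi S x == 0) = (x \in span S).
Proof. by rewrite -(linear0 (lq_pi S)) lq_pi_eq subr0. Qed.

End LinearMaps.

Section KLinear.
Variables (k : fieldType) (A : algType k).

(** The modules carry only their A-structure, so scalars of k act through [c%:A]. Retractions,
    cocycles and homotopies below are merely k-linear. *)
Definition klin (M N : lmodType A) (h : M -> N) :=
  forall (c : k) x y, h (c%:A *: x + y) = c%:A *: h x + h y.

Section KlinTheory.
Variables (M N : lmodType A) (h : M -> N) (hk : klin h).

Lemma klinD : {morph h : x y / x + y}.
Proof. by move=> x y; have := hk 1 x y; rewrite !scale1r. Qed.

Lemma klin0 : h 0 = 0.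
Proof. by apply: (addrI (h 0)); rewrite -klinD !addr0. Qed.

Lemma klinZ c x : h (c%:A *: x) = c%:A *: h x.
Proof. by have := hk c x 0; rewrite klin0 !addr0. Qed.

Lemma klinN : {morph h : x / - x}.
Proof. by move=> x; apply: (addrI (h x)); rewrite -klinD !subrr klin0. Qed.

Lemma klinB : {morph h : x y / x - y}.
Proof. by move=> x y; rewrite klinD klinN. Qed.

Lemma klin_sum I (r : seq I) (P : pred I) F :
  h (\sum_(i <- r | P i) F i) = \sum_(i <- r | P i) h (F i).
Proof. exact: (big_morph h klinD klin0). Qed.

End KlinTheory.

Lemma kscaleC (M : lmodType A) (a : A) (c : k) (x : M) :
  a *: (c%:A *: x) = c%:A *: (a *: x).
Proof. by rewrite !scalerA mulr_algl mulr_algr. Qed.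

Lemma kscaleD (M : lmodType A) (a b : k) (x : M) :
  (a + b)%:A *: x = a%:A *: x + b%:A *: x.
Proof. by rewrite !scalerDl. Qed.

Lemma kscaleA (M : lmodType A) (a b : k) (x : M) :
  (a * b)%:A *: x = a%:A *: (b%:A *: x).
Proof. by rewrite [RHS]scalerA -scalerAl mul1r scalerA. Qed.

Lemma linear_klin (M N : lmodType A) (h : {linear M -> N}) : klin h.
Proof. by move=> c x y; rewrite linearP. Qed.

Lemma scale_klin (M : lmodType A) (a : A) : klin (fun x : M => a *: x).
Proof. by move=> c x y; rewrite scalerDr kscaleC. Qed.

Lemma klin_comp (M N P : lmodType A) (g : N -> P) (h : M -> N) :
  klin g -> klin h -> klin (fun x => g (h x)).
Proof. by move=> gk hk c x y; rewrite hk gk. Qed.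

Lemma klin_zero (M N : lmodType A) : klin (fun _ : M => 0 : N).
Proof. by move=> c x y; rewrite scaler0 addr0. Qed.

Lemma klin_add (M N : lmodType A) (g h : M -> N) :
  klin g -> klin h -> klin (fun x => g x + h x).
Proof. by move=> gk hk c x y; rewrite hk gk scalerDr addrACA. Qed.

Lemma klin_scale (M N : lmodType A) (a : A) (h : M -> N) :
  klin h -> klin (fun x => a *: h x).
Proof. by move=> hk; apply: (klin_comp (scale_klin a)). Qed.

Lemma klin_sub (M N : lmodType A) (g h : M -> N) :
  klin g -> klin h -> klin (fun x => g x - h x).
Proof. by move=> gk hk c x y; rewrite hk gk scalerBr opprD addrACA. Qed.

Lemma klin_bigsum (M N : lmodType A) I (r : seq I) (P : pred I)
    (h : I -> M -> N) :
  (forall i, klin (h i)) -> klin (fun x => \sum_(i <- r | P i) h i x).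
Proof.
move=> hk c x y; rewrite scaler_sumr -big_split /=.
by apply: eq_bigr => i _; rewrite hk.
Qed.

(* a k-basis of M, given by its coordinate isomorphism *)
Record kframe (M : lmodType A) := KFrame {
  kdim : nat;
  kvec : 'rV[k]_kdim -> M;
  kcrd : M -> 'rV[k]_kdim;
  kvecK : cancel kvec kcrd;
  kcrdK : cancel kcrd kvec;
  kvecP : forall c x y, kvec (c *: x + y) = c%:A *: kvec x + kvec y
}.

Arguments kvec {M} _ _.
Arguments kcrd {M} _ _.
Arguments kvecK {M} _ _.
Arguments kcrdK {M} _ _.
Arguments kvecP {M} _ _ _ _.

Section FrameExists.
Variable M : lmodType A.

Definition comb n (s : 'I_n -> M) (c : 'rV[k]_n) : M :=
  \sum_i (c 0 i)%:A *: s i.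

Lemma combP n (s : 'I_n -> M) a x y :
  comb s (a *: x + y) = a%:A *: comb s x + comb s y.
Proof.
rewrite /comb scaler_sumr -big_split; apply: eq_bigr => i _ /=.
by rewrite !mxE kscaleD kscaleA.
Qed.

(** A generating family of minimal length is free, since a nontrivial relation would allow one
    member to be dropped. *)
Lemma fin_dim_frame : fin_dim M -> exists B : kframe M, True.
Proof.
move=> [s sP].
pose P n := `[< exists t : 'I_n -> M, forall m, exists c, m = comb t c >].
have ex_P : exists n, P n.
  exists (size s); apply/asboolP; exists (fun i => s`_i) => m.
  have [c ->] := sP m; exists (\row_i c i); rewrite /comb.
  by apply: eq_bigr => i _; rewrite mxE.
have [n /asboolP[t tP] nmin] := ex_minnP ex_P.
have t_inj : injective (comb t).
  suff t0 c : comb t c = 0 -> c = 0.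
    move=> x y xy; apply/eqP; rewrite -subr_eq0; apply/eqP/t0.
    by rewrite addrC -scaleN1r combP scaleNr scale1r scaleN1r xy addNr.
  move=> tc; apply/rowP => i; rewrite mxE; apply/eqP; apply/negPn/negP => ci.
  case: n t tP {sP} nmin c i tc ci => [|n] t tP nmin c i tc ci.
    by case: i ci.
  have: P n; last by move=> /nmin; rewrite ltnn.
  apply/asboolP; exists (fun j => t (lift i j)) => m; have [d ->] := tP m.
  (* The multiple of the relation c is chosen to make the i-th coordinate vanish. *)
  pose e := d - (d 0 i / c 0 i) *: c.
  have de : comb t d = comb t e.
    by rewrite /e addrC -scaleNr combP tc scaler0 add0r.
  exists (\row_j e 0 (lift i j)); rewrite de /comb (bigD1_ord i) //=.
  rewrite {1}/e !mxE divfK // subrr scale0r scale0r add0r.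
  by apply: eq_bigr => j _; rewrite mxE.
have /choice[g gK] m : exists c, comb t c = m by have [c ->] := tP m; exists c.
by exists (@KFrame M n (comb t) g (fun c => t_inj _ _ (gK _)) gK (@combP n t)).
Qed.

Lemma fin_dim_fintype (I : finType) (b : I -> M) :
  (forall m, exists c : I -> k, m = \sum_i (c i)%:A *: b i) -> fin_dim M.
Proof.
move=> bP; exists [seq b i | i <- enum I] => m; have [c ->] := bP m.
set s := map _ _; have ss : size s = #|I| by rewrite size_map cardE.
exists (fun j => c (enum_val (cast_ord ss j))).
pose e (j : 'I_(size s)) := enum_val (cast_ord ss j).
rewrite (reindex e) /=; last first.
  exists (fun i => cast_ord (esym ss) (enum_rank i)) => i _; rewrite /e.
    by rewrite enum_valK cast_ordK.
  by rewrite cast_ordKV enum_rankK.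
apply: eq_bigr => j _; congr (_ *: _).
have jI : (j < #|I|)%N by rewrite -ss.
have i0 : I := enum_val (Ordinal jI).
by rewrite (nth_map i0) -?cardE // /e (enum_val_nth i0).
Qed.

End FrameExists.

Section FrameTheory.
Variables (M : lmodType A) (B : kframe M).

Lemma kcrdP c x y : kcrd B (c%:A *: x + y) = c *: kcrd B x + kcrd B y.
Proof. by apply: (can_inj (kvecK B)); rewrite kvecP !kcrdK. Qed.

Lemma kvecE v : kvec B v = comb (fun i => kvec B (delta_mx 0 i)) v.
Proof.
have kvD : {morph kvec B : x y / x + y}.
  by move=> x y; have := kvecP B 1 x y; rewrite !scale1r.
have kv0 : kvec B 0 = 0.
  by apply: (addrI (kvec B 0)); rewrite -kvD !addr0.
rewrite {1}[v]row_sum_delta (big_morph _ kvD kv0); apply: eq_bigr => i _.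
by rewrite -[_ *: delta_mx _ _]addr0 kvecP kv0 addr0.
Qed.

Lemma frame_fin_dim : fin_dim M.
Proof.
apply: (fin_dim_fintype (b := fun i => kvec B (delta_mx 0 i))) => m.
by exists (kcrd B m 0); rewrite -{1}[m](kcrdK B) kvecE.
Qed.

End FrameTheory.

End KLinear.

Arguments kvec {k A M} _ _.
Arguments kcrd {k A M} _ _.
Arguments kvecK {k A M} _ _.
Arguments kcrdK {k A M} _ _.
Arguments kvecP {k A M} _ _ _ _.

(** * Matrices and traces of k-linear maps *)

Section KMatrices.
Variables (k : fieldType) (A : algType k).

Lemma kvec0 (M : lmodType A) (B : kframe M) : kvec B 0 = 0.
Proof.
have := kvecP B (-1) 0 0.
by rewrite scaler0 addr0 scaleNr scale1r scaleN1r addNr.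
Qed.

Lemma kcrd0 (M : lmodType A) (B : kframe M) : kcrd B 0 = 0.
Proof. by rewrite -(kvec0 B) kvecK. Qed.

Section Def.
Variables (M N : lmodType A) (B : kframe M) (C : kframe N).

(** Coordinates are row vectors, so matrices act on the right and composition reverses the order of
    the factors. *)
Definition kmx (h : M -> N) : 'M[k]_(kdim B, kdim C) :=
  \matrix_(i, j) kcrd C (h (kvec B (delta_mx 0 i))) 0 j.

Definition kfun (Z : 'M[k]_(kdim B, kdim C)) (x : M) : N :=
  kvec C (kcrd B x *m Z).

Lemma kfun_klin Z : klin (kfun Z).
Proof. by move=> c x y; rewrite /kfun kcrdP mulmxDl -scalemxAl kvecP. Qed.

Lemma kfunP a Y Z x : kfun (a *: Y + Z) x = a%:A *: kfun Y x + kfun Z x.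
Proof. by rewrite /kfun mulmxDr -scalemxAr kvecP. Qed.

Lemma kmxE h x : klin h -> kcrd C (h x) = kcrd B x *m kmx h.
Proof.
move=> hk; rewrite -{1}[x](kcrdK B) kvecE (klin_sum hk).
have cD : {morph kcrd C : y z / y + z}.
  by move=> y z; have := kcrdP C 1 y z; rewrite !scale1r.
rewrite (big_morph _ cD (kcrd0 C)) mulmx_sum_row; apply: eq_bigr => i _.
rewrite (klinZ hk) -[_ *: h _]addr0 kcrdP kcrd0 addr0; congr (_ *: _).
by apply/rowP => j; rewrite !mxE.
Qed.

Lemma kmxK h : klin h -> kfun (kmx h) =1 h.
Proof. by move=> hk x; rewrite /kfun -kmxE // kcrdK. Qed.

Lemma kfunK Z : kmx (kfun Z) = Z.
Proof.
apply/row_matrixP => i; apply/rowP => j.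
by rewrite !mxE /kfun !kvecK -rowE mxE.
Qed.

Lemma kmxP a g h : kmx (fun x => a%:A *: g x + h x) = a *: kmx g + kmx h.
Proof. by apply/matrixP => i j; rewrite !mxE kcrdP !mxE. Qed.

End Def.

Lemma kmx_comp (M N P : lmodType A) (B : kframe M) (C : kframe N)
    (D : kframe P) (g : N -> P) (h : M -> N) : klin g ->
  kmx B D (fun x => g (h x)) = kmx B C h *m kmx C D g.
Proof.
move=> gk; apply/row_matrixP => i; rewrite row_mul.
have -> : row i (kmx B C h) = kcrd C (h (kvec B (delta_mx 0 i))).
  by apply/rowP => j; rewrite !mxE.
by rewrite -kmxE //; apply/rowP => j; rewrite !mxE.
Qed.

Lemma kmx_id (M : lmodType A) (B : kframe M) : kmx B B id = 1%:M.
Proof. by apply/matrixP => i j; rewrite !mxE kvecK !mxE eqxx eq_sym. Qed.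

Definition ktr (M : lmodType A) (B : kframe M) (h : M -> M) : k :=
  \tr (kmx B B h).

Section Trace.
Variables (M : lmodType A) (B : kframe M).

Lemma ktrP a g h :
  ktr B (fun x => a%:A *: g x + h x) = a * ktr B g + ktr B h.
Proof. by rewrite /ktr kmxP mxtraceD mxtraceZ. Qed.

Lemma eq_ktr g h : g =1 h -> ktr B g = ktr B h.
Proof. by move=> /funext ->. Qed.

Lemma ktr0 : ktr B (fun=> 0) = 0.
Proof.
have := ktrP (-1) (fun=> 0) (fun=> 0); rewrite mulN1r addNr => <-.
by apply: eq_ktr => x; rewrite scaler0 addr0.
Qed.

Lemma ktrD g h : ktr B (fun x => g x + h x) = ktr B g + ktr B h.
Proof.
by rewrite -[ktr B g]mul1r -ktrP; apply: eq_ktr => x; rewrite !scale1r.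
Qed.

Lemma ktrZ a h : ktr B (fun x => a%:A *: h x) = a * ktr B h.
Proof.
rewrite -[RHS]addr0 -[X in _ + X]ktr0 -ktrP.
by apply: eq_ktr => x; rewrite addr0.
Qed.

Lemma ktrB g h : ktr B (fun x => g x - h x) = ktr B g - ktr B h.
Proof.
rewrite -mulN1r -ktrZ -ktrD; apply: eq_ktr => x.
by rewrite scaleNr scale1r scaleN1r.
Qed.

Lemma ktr_sum I (r : seq I) (P : pred I) F :
  ktr B (fun x => \sum_(i <- r | P i) F i x) = \sum_(i <- r | P i) ktr B (F i).
Proof.
elim: r => [|i r IH].
  by rewrite big_nil -[RHS]ktr0; apply: eq_ktr => x; rewrite big_nil.
rewrite big_cons; case Pi: (P i).
  by rewrite -IH -ktrD; apply: eq_ktr => x; rewrite big_cons Pi.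
by rewrite -IH; apply: eq_ktr => x; rewrite big_cons Pi.
Qed.

Lemma ktrC (N : lmodType A) (C : kframe N) (g : N -> M) (h : M -> N) :
  klin g -> klin h -> ktr B (fun x => g (h x)) = ktr C (fun x => h (g x)).
Proof.
move=> gk hk; rewrite /ktr (kmx_comp B C B h gk) (kmx_comp C B C g hk).
exact: mxtrace_mulC.
Qed.

(** Testing against the map of an elementary matrix reads off a single entry of the matrix of d. *)
Lemma ktr_nondeg (N : lmodType A) (C : kframe N) (d : N -> M) : klin d ->
  (forall phi : M -> N, klin phi -> ktr B (fun x => d (phi x)) = 0) ->
  forall x, d x = 0.
Proof.
move=> dk h; have d0 : kmx C B d = 0.
  apply/matrixP => i j; rewrite [RHS]mxE.
  have := h _ (kfun_klin (delta_mx j i : 'M_(kdim B, kdim C))).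
  rewrite /ktr (kmx_comp B C B _ dk) kfunK => <-.
  have dE l j' :
      (delta_mx j i *m kmx C B d) l j' = (l == j)%:R * kmx C B d i j'.
    rewrite [LHS]mxE (bigD1 i) //= big1 ?addr0 => [|l' /negPf li].
      by rewrite [delta_mx _ _ _ _]mxE eqxx andbT.
    by rewrite [delta_mx _ _ _ _]mxE li andbF mul0r.
  rewrite /mxtrace (bigD1 j) //= big1 ?addr0 => [|l /negPf lj].
    by rewrite dE eqxx mul1r.
  by rewrite dE lj mul0r.
by move=> x; rewrite -[d x](kcrdK B) (kmxE C B _ dk) d0 mulmx0 kvec0.
Qed.

Lemma ktr_nilpotent h n : klin h -> (forall x, iter n h x = 0) -> ktr B h = 0.
Proof.
move=> hk hn; apply: (@mxtrace_nilpotent _ _ n).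
have iterk m : klin (iter m h) /\ kmx B B h ^+ m = kmx B B (iter m h).
  elim: m => [|m [ik IH]]; first by rewrite expr0 (kmx_id B).
  split; first exact: (klin_comp hk).
  by rewrite exprSr IH -[_ * _]/(_ *m _) -(kmx_comp B B B _ hk).
have -> := (iterk n).2; have /funext -> : iter n h =1 fun=> 0 by [].
by apply/matrixP => i j; rewrite !mxE kcrd0 mxE.
Qed.

End Trace.

End KMatrices.

(** * Finite-dimensional modules *)

Section FiniteDimension.
Variables (k : fieldType) (A : algType k).

Lemma fin_dim_surj (M N : lmodType A) (h : M -> N) :
  klin h -> (forall y, exists x, h x = y) -> fin_dim M -> fin_dim N.
Proof.
move=> hk hs /fin_dim_frame[B _].
apply: (fin_dim_fintype (b := fun i => h (kvec B (delta_mx 0 i)))) => y.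
have [x <-] := hs y; exists (kcrd B x 0).
rewrite -{1}[x](kcrdK B) kvecE (klin_sum hk).
by apply: eq_bigr => i _; rewrite (klinZ hk).
Qed.

Lemma fin_dim_prod (M N : lmodType A) :
  fin_dim M -> fin_dim N -> fin_dim (M * N)%type.
Proof.
move=> /fin_dim_frame[B _] /fin_dim_frame[C _].
pose b (i : 'I_(kdim B) + 'I_(kdim C)) : (M * N)%type :=
  match i with inl i => (kvec B (delta_mx 0 i), 0)
             | inr j => (0, kvec C (delta_mx 0 j)) end.
apply: (fin_dim_fintype (b := b)) => -[x y].
exists (fun i => match i with inl i => kcrd B x 0 i
                            | inr j => kcrd C y 0 j end).
have l1 : klin (fun x : M => (x, 0) : (M * N)%type).
  by move=> c u w; congr pair; rewrite /= scaler0 addr0.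
have l2 : klin (fun y : N => (0, y) : (M * N)%type).
  by move=> c u w; congr pair; rewrite /= scaler0 addr0.
rewrite big_sumType /= -{1}[x](kcrdK B) -{1}[y](kcrdK C) !kvecE.
set x' := comb _ _; set y' := comb _ _.
transitivity ((x', 0) + (0, y') : (M * N)%type).
  by congr pair; rewrite ?addr0 ?add0r.
rewrite /x' /y' /comb (klin_sum l1) (klin_sum l2).
by congr (_ + _); apply: eq_bigr => i _; rewrite ?(klinZ l1) ?(klinZ l2).
Qed.

Section TwoFrames.
Variables (M N : lmodType A) (B : kframe M) (C : kframe N).

Lemma klin_retraction (h : M -> N) : klin h -> injective h ->
  exists2 r : N -> M, klin r & forall x, r (h x) = x.
Proof.
move=> hk hi; have : row_free (kmx B C h).
  apply: inj_row_free => u uh.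
  suff : kvec B u = 0 by move=> /(congr1 (kcrd B)); rewrite kvecK kcrd0.
  apply: hi; rewrite (klin0 hk) -[h _](kcrdK C) (kmxE B C _ hk) kvecK uh.
  exact: kvec0.
move=> /row_freeP[Z hZ]; exists (kfun Z); first exact: kfun_klin.
by move=> x; rewrite /kfun (kmxE B C _ hk) -mulmxA hZ mulmx1 kcrdK.
Qed.

(** A finite-dimensional separation theorem: a family outside the subspace K is detected by a
    functional vanishing on K, and the trace pairing represents this functional by maps in the
    opposite direction. *)
Lemma kseparate (I : finType) (K : (I -> M -> N) -> Prop) (w : I -> M -> N) :
  K (fun _ _ => 0) ->
  (forall a f g, K f -> K g -> K (fun i x => a%:A *: f i x + g i x)) ->
  (forall i, klin (w i)) -> ~ K w ->
  exists c : I -> N -> M, [/\ forall i, klin (c i),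
    forall f, (forall i, klin (f i)) -> K f ->
      \sum_i ktr B (fun x => c i (f i x)) = 0
  & \sum_i ktr B (fun x => c i (w i x)) != 0].
Proof.
move=> K0 KP wk Kw.
pose fam (Z : {ffun I -> 'M[k]_(kdim B, kdim C)}) i := kfun (Z i) : M -> N.
pose K' : {pred {ffun I -> 'M[k]_(kdim B, kdim C)}} :=
  fun Z => `[< K (fam Z) >].
have mxfam f : (forall i, klin (f i)) -> fam [ffun i => kmx B C (f i)] = f.
  by move=> fk; apply: funext => i; apply: funext => x; rewrite /fam ffunE kmxK.
have K'c : GRing.submod_closed K'.
  split=> [|a Y Z /asboolP KY /asboolP KZ]; apply/asboolP.
    rewrite (_ : fam 0 = fun _ _ => 0) //.
    apply: funext => i; apply: funext => x.
    by rewrite /fam ffunE /kfun mulmx0 kvec0.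
  rewrite (_ : fam _ = fun i x => a%:A *: fam Y i x + fam Z i x).
    exact: KP.
  by apply: funext => i; apply: funext => x; rewrite /fam !ffunE kfunP.
have wK' : [ffun i => kmx B C (w i)] \notin K'.
  by apply/asboolPn; rewrite mxfam.
have [psi [psiK psiw]] := ffmx_separate K'c wK'.
have trE f : (forall i, klin (f i)) ->
    \sum_i ktr B (fun x => kfun (psi i) (f i x)) =
    \sum_i \tr ([ffun i => kmx B C (f i)] i *m psi i).
  move=> fk; apply: eq_bigr => i _.
  by rewrite /ktr (kmx_comp B C B _ (kfun_klin _)) kfunK ffunE.
exists (fun i => kfun (psi i)); split=> [i|f fk Kf|]; first exact: kfun_klin.
  by rewrite trE // psiK //; apply/asboolP; rewrite mxfam.
by rewrite trE.
Qed.

End TwoFrames.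

Lemma klin_endo_surj (M : lmodType A) (h : M -> M) : fin_dim M ->
  klin h -> injective h -> forall y, exists x, h x = y.
Proof.
move=> /fin_dim_frame[B _] hk hi y.
have [r rk rh] := klin_retraction B B hk hi.
exists (r y); have := kmx_comp B B B h rk.
have -> : (fun x => r (h x)) = id by apply: funext.
rewrite kmx_id => /esym/mulmx1C; rewrite -(kmx_comp B B B r hk) => e.
by rewrite -[LHS](kmxK B B (klin_comp hk rk)) e /kfun mulmx1 kcrdK.
Qed.

(** Connects traces with the dimensions that define regularity. A row basis of the matrix of e gives
    the basis of its image. *)
Lemma idempotent_kdim (M : lmodType A) (B : kframe M) (e : M -> M) :
  klin e -> (forall x, e (e x) = e x) ->
  exists2 d, is_kdim (fun x => exists y, x = e y) d & ktr B e = d%:R.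
Proof.
move=> ek ee; have EE : kmx B B e *m kmx B B e = kmx B B e.
  by rewrite -(kmx_comp B B B e ek); congr (kmx B B _); apply: funext.
exists (\rank (kmx B B e)); last exact: mxtrace_idempotent.
set E := kmx B B e in EE *; pose b i := kvec B (row i (row_base E)).
have imE x : e x = kvec B (kcrd B x *m E) by rewrite -(kmxE B B _ ek) kcrdK.
have rE u : (u <= E)%MS -> u *m E = u.
  by move=> /submxP[D ->]; rewrite -mulmxA EE.
have combE (c : {ffun 'I_(\rank E) -> k}) :
    \sum_(i < \rank E) (c i)%:A *: b i = kvec B (\row_i c i *m row_base E).
  rewrite mulmx_sum_row; have kvD : {morph kvec B : x y / x + y}.
    by move=> x y; have := kvecP B 1 x y; rewrite !scale1r.
  rewrite (big_morph _ kvD (kvec0 B)); apply: eq_bigr => i _.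
  by rewrite -[_ *: row _ _]addr0 kvecP kvec0 addr0 mxE.
exists b; split=> [i|m [y ->]].
  exists (b i); rewrite imE /b kvecK rE //.
  by rewrite (submx_trans (row_sub i _)) // eq_row_base.
have /submxP[D DE] : (kcrd B y *m E <= row_base E)%MS.
  by rewrite eq_row_base submxMl.
exists [ffun i => D 0 i]; split=> [|c].
  rewrite combE imE DE; congr (kvec B (_ *m _)).
  by apply/rowP => i; rewrite !mxE ffunE.
rewrite combE imE DE => /(can_inj (kvecK B)).
move=> /(row_free_inj (row_base_free E)) Dc.
by apply/ffunP => i; rewrite Dc ffunE mxE.
Qed.

(** For a power phi of psi of minimal rank, phi and its square have the same image and the same
    kernel. Hence M is the direct sum of the two, and indecomposability kills one of them. *)
Lemma fitting (M : lmodType A) (psi : {linear M -> M}) :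
  fin_dim M -> indecomposable M ->
  bijective psi \/ exists n, forall x, iter n psi x = 0.
Proof.
move=> /fin_dim_frame[B _] [_ Mi].
have psik := linear_klin psi.
pose P := kmx B B psi.
have itl n : linear (iter n psi).
  by elim: n => [|n IH] a x y //=; rewrite IH linearP.
have itk n : klin (iter n psi) by move=> c x y; rewrite itl.
have itP n : kmx B B (iter n psi) = P ^+ n.
  elim: n => [|n IH]; first by rewrite expr0 (kmx_id B).
  by rewrite exprSr -IH -[_ * _]/(_ *m _) -(kmx_comp B B B _ psik).
(* Only positive exponents are used, so that bijectivity of the power gives bijectivity of [psi]. *)
have ex_r : exists r, `[< exists n, \rank (P ^+ n.+1) = r >].
  by exists (\rank (P ^+ 1)); apply/asboolP; exists 0.
have [r /asboolP[n nr] rmin] := ex_minnP ex_r.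
have rk2 : \rank (P ^+ n.+1 *m P ^+ n.+1) = \rank (P ^+ n.+1).
  apply/eqP; rewrite eqn_leq mxrankM_maxl nr rmin //.
  by apply/asboolP; exists (n + n.+1)%N; rewrite -[_ *m _]/(_ * _) -exprD.
have [phi phiE] := linear_pack (itl n.+1).
have phik := linear_klin phi.
have phiP : kmx B B phi = P ^+ n.+1 by rewrite -itP; congr kmx; apply: funext.
have phiX x : phi x = kvec B (kcrd B x *m P ^+ n.+1).
  by rewrite -phiP -(kmxE B B _ phik) kcrdK.
have im2 x : exists y, phi x = phi (phi y).
  have /submxP[D DE] : (kcrd B x *m P ^+ n.+1 <= P ^+ n.+1 *m P ^+ n.+1)%MS.
    apply: submx_trans (submxMl _ _) _.
    have [_] := mxrank_leqif_eq (submxMl (P ^+ n.+1) (P ^+ n.+1)).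
    by rewrite rk2 eqxx => /esym/andP[].
  by exists (kvec B D); rewrite !phiX !kvecK -mulmxA -DE.
have ker2 y : phi (phi y) = 0 -> phi y = 0.
  have := mxrank_mul_ker (P ^+ n.+1) (P ^+ n.+1); rewrite rk2.
  move=> /eqP; rewrite -[X in _ == X]addn0 eqn_add2l mxrank_eq0 => /eqP cap0.
  rewrite !phiX kvecK => /(congr1 (kcrd B)); rewrite kvecK kcrd0 => yPP.
  suff -> : kcrd B y *m P ^+ n.+1 = 0 by rewrite kvec0.
  apply/eqP; rewrite -submx0 -cap0 sub_capmx submxMl /=.
  by apply/sub_kermxP.
pose S1 x := phi x = 0; pose S2 x := exists y, x = phi y.
have S1E x : x \in span S1 -> S1 x.
  apply: span_id => [|a u w]; rewrite /S1 ?linear0 // => hu hw.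
  by rewrite linearP hu hw scaler0 addr0.
have S2E x : x \in span S2 -> S2 x.
  apply: span_id => [|a u w [u' ->] [w' ->]].
    by exists 0; rewrite linear0.
  by exists (a *: u' + w'); rewrite linearP.
(* The decomposition takes the form of the product of M / ker phi and M / im phi. *)
pose f x : (lquot S1 * lquot S2)%type := (lq_pi S1 x, lq_pi S2 x).
have fl : linear f by move=> a x y; congr pair; rewrite linearP.
have [F FE] := linear_pack fl.
have Fb : bijective F.
  apply: bijective_inj_surj => [x y|[t1 t2]].
    rewrite !FE => -[/eqP + /eqP]; rewrite !lq_pi_eq => /S1E h1 /S2E[z h2].
    apply/eqP; rewrite -subr_eq0 h2 ker2 //; first by rewrite -h2.
  elim/lq_ind: t1 => x1; elim/lq_ind: t2 => x2.
  have [y1 e1] := im2 x1; have [y2 e2] := im2 x2.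
  (* The image part of [x1] plus the kernel part of [x2]. *)
  exists (phi y1 + (x2 - phi y2)); rewrite FE /f.
  congr pair; apply/eqP; rewrite lq_pi_eq span_sub //.
    by rewrite /S1 !linearB !linearD !linearN /= e1 e2 subrr addr0 subrr.
  by exists (y1 - y2); rewrite linearB addrCA addrAC subrr add0r.
have [X0|Y0] := Mi _ _ F Fb; [right|left].
  exists n.+1 => x; rewrite -phiE; apply: S1E.
  by have /eqP := X0 (lq_pi S1 x); rewrite lq_pi_eq0.
have phis x : exists y, x = phi y.
  by apply: S2E; have /eqP := Y0 (lq_pi S2 x); rewrite lq_pi_eq0.
apply: bijective_inj_surj => [x y xy|y]; last first.
  by have [x ->] := phis y; exists (iter n psi x); rewrite phiE.
apply/eqP; rewrite -subr_eq0; apply/eqP; have [z zE] := phis (x - y).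
rewrite zE ker2 // -zE phiE iterSr linearB xy subrr.
by elim: (n) => //= m ->; rewrite linear0.
Qed.

End FiniteDimension.

(** * Representations of quivers as modules over the path algebra *)

Section RestrictScalars.
Variables (k : fieldType) (A : algType k) (M : lmodType A).

(** An alias of M carrying the restricted scalars, kept apart from the A-module structure. It allows
    modules to serve as underlying spaces of representations. *)
Definition kspace : Type := M.
HB.instance Definition _ := GRing.Zmodule.on kspace.

Definition kscale (c : k) (x : kspace) : kspace := c%:A *: (x : M).

Fact kscale_A a b x : kscale a (kscale b x) = kscale (a * b) x.
Proof. by rewrite /kscale kscaleA. Qed.
Fact kscale_1 : left_id 1 kscale.
Proof. by move=> x; rewrite /kscale !scale1r. Qed.
Fact kscale_Dr : right_distributive kscale +%R.
Proof. by move=> a x y; apply: (@scalerDr A M). Qed.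
Fact kscale_Dl x : {morph kscale^~ x : a b / a + b}.
Proof. by move=> a b; apply: kscaleD. Qed.

HB.instance Definition _ := GRing.Zmodule_isLmodule.Build k kspace
  kscale_A kscale_1 kscale_Dr kscale_Dl.

End RestrictScalars.

Section Representations.
Variables (k : fieldType) (Q : quiver).

(* An arrow a acts from the component at its head to the one at its tail, as
   paths are composed from left to right and act on the left. *)
Record rep := Rep {
  rsp : lmodType k;
  rvert : vert Q -> rsp -> rsp;
  rarr : arr Q -> rsp -> rsp;
  rvert_linear : forall i, linear (rvert i);
  rarr_linear : forall a, linear (rarr a);
  rvertM : forall i j x, rvert i (rvert j x) = if i == j then rvert j x else 0;
  rvert1 : forall x, \sum_i rvert i x = x;
  rarr_tail : forall a x, rvert (tail a) (rarr a x) = rarr a x;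
  rarr_head : forall a x, rarr a (rvert (head a) x) = rarr a x
}.

Variable R : rep.

(** The projection at the final vertex j is applied first, so that the empty walk acts as the
    idempotent at j. *)
Definition rwalk (j : vert Q) (s : seq (arr Q)) (x : rsp R) : rsp R :=
  foldr (@rarr R) (rvert j x) s.

Definition rpath (p : qpath Q) (x : rsp R) : rsp R :=
  rwalk (ptgt p) (parr p) x.

Fact rwalk_linear j s : linear (rwalk j s).
Proof.
by elim: s => [|a s IH] c x y; rewrite /= ?rvert_linear // IH rarr_linear.
Qed.

Fact rpath_linear p : linear (rpath p).
Proof. exact: rwalk_linear. Qed.

Lemma rwalk_src i s j x : walk i s ->
  rvert i (rwalk (walk_end i s) s x) = rwalk (walk_end i s) s x /\
  (j != i -> rvert j (rwalk (walk_end i s) s x) = 0).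
Proof.
case: s => [_|a s] /=; first by rewrite !rvertM eqxx; split=> // /negPf ->.
case/andP => /eqP <- _; rewrite rarr_tail.
by split=> // /negPf ji; rewrite -rarr_tail rvertM ji.
Qed.

Lemma rwalk_cat j s s' x :
  rwalk j (s ++ s') x = foldr (@rarr R) (rwalk j s' x) s.
Proof. by rewrite /rwalk foldr_cat. Qed.

Definition ropath (o : option (qpath Q)) (x : rsp R) : rsp R :=
  if o is Some p then rpath p x else 0.

Lemma rpathM p q x : rpath p (rpath q x) = ropath (pconc p q) x.
Proof.
have [h1 h2] := rwalk_src (ptgt p) x (qpath_walk q).
have [pq|npq] := eqVneq (ptgt p) (psrc q).
  have [r -> rE] := pconc_some pq.
  rewrite /= /rpath {1}/rwalk pq h1 -rwalk_cat.
  congr (rwalk _ _ _); rewrite /ptgt /psrc /parr rE //= walk_end_cat.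
  by rewrite -/(ptgt p) pq.
rewrite pconc_none // {1}/rpath /rwalk h2 //=.
have ra0 a : rarr a 0 = 0 :> rsp R.
  by have := @rarr_linear R a (-1) 0 0; rewrite scaler0 addr0 scaleN1r addNr.
by elim: (parr p) => //= a s ->.
Qed.

Definition ract (f : path_alg k Q) (x : rsp R) : rsp R :=
  lext (fun p => rpath p x) f.

Fact ract_linl x : linear (ract^~ x).
Proof. exact: lext_is_linear. Qed.

Fact ract_linr f : linear (ract f).
Proof.
move=> c x y; rewrite /ract /lext scaler_sumr -big_split; apply: eq_bigr => p _.
by rewrite /= rpath_linear scalerDr scalerA mulrC -scalerA.
Qed.

Lemma ract_pmon p x : ract (pmon k p) x = rpath p x.
Proof. exact: lextU. Qed.

Lemma ract0l x : ract 0 x = 0.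
Proof.
by have := ract_linl x (-1) 0 0; rewrite scaler0 addr0 scaleN1r addNr.
Qed.

Lemma ract0r f : ract f 0 = 0.
Proof.
by have := ract_linr f (-1) 0 0; rewrite scaler0 addr0 scaleN1r addNr.
Qed.

Fact ractA f g x : ract f (ract g x) = ract (f * g) x.
Proof.
elim/path_alg_ind: f => [|a p f IH]; first by rewrite mul0r !ract0l.
rewrite mulrDl -scalerAl !ract_linl IH; congr (_ *: _ + _).
elim/path_alg_ind: g {IH} => [|b q g IH]; first by rewrite mulr0 !ract0l ract0r.
rewrite mulrDr -scalerAr !ract_linl ract_linr IH; congr (_ *: _ + _).
rewrite !ract_pmon rpathM [pmon k p * _]pmulE.
by case: (pconc p q) => [r|] /=; rewrite ?ract_pmon ?ract0l.
Qed.

Fact ract1 : left_id 1 ract.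
Proof.
move=> x; have rD : {morph ract^~ x : f g / f + g}.
  by move=> f g; have := ract_linl x 1 f g; rewrite !scale1r.
rewrite -[RHS](rvert1 x) /(1 : path_alg k Q).
rewrite [ract _ _](big_morph _ rD (ract0l x)).
by apply: eq_bigr => i _; rewrite ract_pmon.
Qed.

Definition rep_mod : Type := rsp R.
HB.instance Definition _ := GRing.Zmodule.on rep_mod.

Fact ractDr : right_distributive (ract : _ -> rep_mod -> rep_mod) +%R.
Proof. by move=> f x y; have := ract_linr f 1 x y; rewrite !scale1r. Qed.
Fact ractDl (x : rep_mod) :
  {morph (ract : _ -> rep_mod -> rep_mod)^~ x : f g / f + g}.
Proof. by move=> f g; have := ract_linl x 1 f g; rewrite !scale1r. Qed.

HB.instance Definition _ := GRing.Zmodule_isLmodule.Build (path_alg k Q) rep_mod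
  ractA ract1 ractDr ractDl.

Lemma rep_algE (c : k) (x : rep_mod) : c%:A *: x = c *: (x : rsp R).
Proof.
rewrite -[LHS]/(ract (c *: 1) x) -[c *: 1]addr0 ract_linl ract0l addr0.
by rewrite ract1.
Qed.

Lemma rep_idemE i (x : rep_mod) : idem k i *: x = rvert i x.
Proof. exact: ract_pmon. Qed.

Lemma rep_arrowE a (x : rep_mod) : arrow k a *: x = rarr a x.
Proof. by rewrite [LHS]ract_pmon /rpath /= rarr_head. Qed.

End Representations.

Section PathAlgebraTheory.
Variables (k : fieldType) (Q : quiver).
Local Notation A := (path_alg k Q).

Lemma idemE i j : idem k i * idem k j = if i == j then idem k j else 0 :> A.
Proof. by rewrite [LHS]pmulE pconc1p; case: ifP. Qed.

Lemma sum_idem : \sum_i idem k i = 1 :> A.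
Proof. by []. Qed.

Lemma idem_arrow i (a : arr Q) :
  idem k i * arrow k a = if i == tail a then arrow k a else 0.
Proof. by rewrite [LHS]pmulE pconc1p; case: ifP. Qed.

Lemma arrow_idem i (a : arr Q) :
  arrow k a * idem k i = if i == head a then arrow k a else 0.
Proof. by rewrite [LHS]pmulE pconcp1; case: ifP. Qed.

Lemma tail_arrow (a : arr Q) : idem k (tail a) * arrow k a = arrow k a.
Proof. by rewrite idem_arrow eqxx. Qed.

Lemma arrow_head (a : arr Q) : arrow k a * idem k (head a) = arrow k a.
Proof. by rewrite arrow_idem eqxx. Qed.

Lemma pmon_arrow_cons i a (s : seq (arr Q)) (w : walk i (a :: s))
    (w' : walk (head a) s) :
  pmon k (@QPath Q (i, a :: s) w) =
  arrow k a * pmon k (@QPath Q (head a, s) w').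
Proof.
rewrite [RHS]pmulE.
have [|x -> xE] := @pconc_some _ (arrow_path a) (@QPath Q (head a, s) w').
  by [].
congr (pmon k _); apply: val_inj; rewrite xE /=.
by case/andP: (w) => /eqP <-.
Qed.

(** Every path arises from a trivial one by multiplying with arrows on the left, so linear
    identities need checking on these generators only. *)
Lemma path_alg_gen (P : A -> Prop) :
  P 0 -> (forall c x y, P x -> P y -> P (c *: x + y)) ->
  (forall i, P (idem k i)) -> (forall a x, P x -> P (arrow k a * x)) ->
  forall x, P x.
Proof.
move=> P0 PP Pi Pa; elim/path_alg_ind => // c p f; apply: PP.
case: p => -[i s]; elim: s i => [|a s IH] i w.
  by rewrite (_ : QPath w = trivial_path i); [exact: Pi|exact: val_inj].
by have /andP[_ w'] := w; rewrite (pmon_arrow_cons w w'); apply: Pa.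
Qed.

Lemma alg_smul (M : lmodType A) c (x y : A) (m : M) :
  (c *: x + y) *: m = c%:A *: (x *: m) + y *: m.
Proof. by rewrite scalerDl scalerA mulr_algl. Qed.

Lemma sum_idem_scale (M : lmodType A) (m : M) : \sum_i idem k i *: m = m.
Proof. by rewrite -scaler_suml sum_idem scale1r. Qed.

Lemma klin_linear (M N : lmodType A) (h : M -> N) : klin h ->
  (forall i x, h (idem k i *: x) = idem k i *: h x) ->
  (forall a x, h (arrow k a *: x) = arrow k a *: h x) -> linear h.
Proof.
move=> hk hi ha; suff hZ a x : h (a *: x) = a *: h x.
  by move=> a x y; rewrite (klinD hk) hZ.
elim/path_alg_gen: a x => [|c a b IHa IHb|i|a b IH] x.
- by rewrite !scale0r (klin0 hk).
- by rewrite !alg_smul hk IHa IHb.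
- exact: hi.
- by rewrite -!scalerA ha IH.
Qed.

(** * Finiteness of the set of paths *)

Definition precedes : rel (vert Q) := fun i j =>
  [exists a : arr Q, (tail a == i) && (head a == j)].

Lemma connect_walk i j : connect precedes i j ->
  exists2 s, walk i s & walk_end i s = j.
Proof.
case/connectP => p; elim: p i => [|l p IH] i /=; first by exists [::].
case/andP => /existsP[a /andP[/eqP ta /eqP ha]] pp /(IH l pp)[s ws es].
by exists (a :: s) => /=; rewrite ?ta ?eqxx /walk_end /= ha.
Qed.

(** Along each arrow the set of reachable vertices shrinks strictly: the tail is not reachable from
    the head, as this would close a cycle. *)
Lemma acyclic_walk_size i (s : seq (arr Q)) :
  acyclic Q -> walk i s -> (size s < #|vert Q|)%N.
Proof.
move=> ac w.
have : (size s < #|connect precedes i|)%N.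
  elim: s i w => [|a s IH] i /= => [_|/andP[/eqP <- /IH]].
    by apply/card_gt0P; exists i; rewrite inE connect0.
  move=> lt; apply: leq_ltn_trans lt (proper_card _); apply/properP; split.
    apply/subsetP => j; rewrite !inE; apply: connect_trans.
    by apply: connect1; apply/existsP; exists a; rewrite !eqxx.
  exists (tail a); rewrite inE ?connect0 //.
  apply/negP => /connect_walk[u wu eu].
  have wu' : walk (tail a) (a :: u) by rewrite /= eqxx.
  have := ac (@QPath Q (tail a, a :: u) wu') isT.
  by rewrite /ptgt /psrc /parr /walk_end /= -/(walk_end (head a) u) eu eqxx.
by move=> lt; exact: leq_trans lt (max_card _).
Qed.

Lemma acyclic_finite_paths : acyclic Q ->
  exists L : seq (qpath Q), forall p, p \in L.
Proof.
move=> ac; pose n := #|vert Q|.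
pose T : finType := (vert Q * {l : 'I_n & l.-tuple (arr Q)})%type.
exists (pmap (fun x : T => insub (x.1, val (tagged x.2))) (enum T)) => p.
rewrite mem_pmap; apply/mapP.
have sp := acyclic_walk_size ac (qpath_walk p).
pose t : {l : 'I_n & l.-tuple (arr Q)} :=
  Tagged _ (in_tuple (parr p) : (Ordinal sp).-tuple _).
exists (psrc p, t); first exact: mem_enum.
by rewrite /= -[LHS](valK p) /psrc /parr; case: (val p).
Qed.

(** The finitely many paths span A over k, so their products with the generators span M. Generation
    is stated as an induction principle. *)
Lemma fin_dim_gen (M : lmodType A) (I : finType) (b : I -> M) : acyclic Q ->
  (forall P : M -> Prop, P 0 ->
     (forall a i x, P x -> P (a *: b i + x)) -> forall x, P x) ->
  fin_dim M.
Proof.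
move=> /acyclic_finite_paths[L LP] gen.
pose B (pi : seq_sub L * I) := pmon k (ssval pi.1) *: b pi.2.
apply: (fin_dim_fintype (b := B)).
apply: gen => [|a i x].
  by exists (fun=> 0); rewrite big1 // => pi _; rewrite !scale0r.
elim/path_alg_ind: a x => [|c p f IH] x; first by rewrite scale0r add0r.
move=> /IH[d dE]; pose pi : seq_sub L * I := (SeqSub (LP p), i).
rewrite alg_smul -addrA dE (bigD1 pi) //= addrA -kscaleD.
exists (fun qj => if qj == pi then c + d pi else d qj).
rewrite [RHS](bigD1 pi) //= eqxx; congr (_ + _).
by apply: eq_bigr => qj /negPf ->.
Qed.

Lemma kpair_idem1 (M X : lmodType A) (w : (kspace M * kspace X)%type) :
  \sum_i ((idem k i *: (w.1 : M), idem k i *: (w.2 : X))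
            : (kspace M * kspace X)%type) = w.
Proof.
case: w => m x; rewrite [LHS]surjective_pairing; congr pair.
  rewrite (big_morph fst (fun _ _ => erefl) erefl).
  exact: (sum_idem_scale (m : M)).
rewrite (big_morph snd (fun _ _ => erefl) erefl).
exact: (sum_idem_scale (x : X)).
Qed.

Definition weight_elt (v : vert Q -> k) : A := \sum_i v i *: idem k i.

Lemma idem_weight v i : idem k i * weight_elt v = v i *: idem k i.
Proof.
rewrite /weight_elt mulr_sumr (bigD1 i) //= big1 => [|j /negPf ji].
  by rewrite -scalerAr idemE eqxx addr0.
by rewrite -scalerAr idemE eq_sym ji scaler0.
Qed.

Lemma weight_invK v : (forall i, v i != 0) ->
  weight_elt (fun i => (v i)^-1) * weight_elt v = 1.
Proof.
move=> v0; rewrite -sum_idem {1}/weight_elt mulr_suml; apply: eq_bigr => i _.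
by rewrite -scalerAl idem_weight scalerA mulVf ?scale1r.
Qed.

(** The idempotent at i has trace dim(e_i M), so the trace of v acting on M is the sum that
    regularity requires to be nonzero. *)
Lemma ktr_weight (M : lmodType A) (B : kframe M) v : regular_weight v ->
  indecomposable M -> ktr B (fun x => weight_elt v *: x) != 0.
Proof.
move=> vr Mi.
have dP i : exists d, is_kdim (fun x : M => exists y, x = idem k i *: y) d /\
    ktr B (fun x => idem k i *: x) = d%:R.
  have [||d dd dt] := @idempotent_kdim k A M B (fun x => idem k i *: x).
  - exact: scale_klin.
  - by move=> x; rewrite scalerA idemE eqxx.
  by exists d.
have [d dE] := choice dP.
have := vr M (frame_fin_dim B) Mi d (fun i => (dE i).1).
congr (_ != 0); transitivity (\sum_i v i * ktr B (fun x => idem k i *: x)).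
  by apply: eq_bigr => i _; rewrite (dE i).2.
under eq_bigr => i _ do rewrite -ktrZ.
rewrite -ktr_sum; apply: eq_ktr => x; rewrite /weight_elt scaler_suml.
by apply: eq_bigr => i _; rewrite scalerA mulr_algl.
Qed.

(** * Simple modules and sincerity of regular weights *)

Section SimpleModule.
Variable i : vert Q.

Definition simple_rep : rep k Q.
Proof.
refine (@Rep k Q k^o (fun j x => if j == i then x else 0) (fun _ _ => 0)
  _ _ _ _ _ _).
- by move=> j c x y; case: eqP => //; rewrite scaler0 addr0.
- by move=> a c x y; rewrite scaler0 addr0.
- by move=> j l x; case: (eqVneq l i) => [->|_]; rewrite ?if_same.
- by move=> x; rewrite (bigD1 i) //= eqxx big1 ?addr0 // => j /negPf ->.
- by move=> a x; case: eqP.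
- by [].
Defined.

Lemma simple_indecomposable : indecomposable (rep_mod simple_rep).
Proof.
split; first by exists (1 : k); exact: oner_neq0.
move=> X Y f [g fK gK].
have [X0|/existsNP[x x0]] := pselect (forall x : X, x = 0); first by left.
right=> y; pose u : k := g (x, 0); pose w : k := g (0, y).
have u0 : u != 0.
  apply/eqP => u0; apply: x0; have := gK (x, 0).
  by rewrite -[g _]/(u : rep_mod simple_rep) u0 linear0 => -[].
have := gK (0, y).
have -> : g (0, y) = (w / u)%:A *: g (x, 0).
  by rewrite rep_algE -[RHS]/(w / u * u) divfK.
by rewrite linearZ /= gK => -[_ <-]; rewrite scaler0.
Qed.

Lemma simple_kdim j :
  is_kdim (fun x : rep_mod simple_rep => exists y, x = idem k j *: y) (j == i).
Proof.
have idE (x : rep_mod simple_rep) : idem k j *: x = if j == i then x else 0.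
  exact: rep_idemE.
case: eqP idE => ji idE /=.
  exists (fun=> 1 : k); split=> [l|m _]; first by exists (1 : k); rewrite idE.
  exists [ffun=> m : k]; split=> [|c ->].
    by rewrite big_ord1 rep_algE ffunE -[RHS]/((m : k) * 1) mulr1.
  apply/ffunP => l; rewrite big_ord1 rep_algE ffunE -[LHS]/(c ord0 * 1) mulr1.
  by rewrite (ord1 l).
exists (fun=> 0); split=> [[]//|m [y ->]]; exists [ffun=> 0].
by split=> [|c _]; [rewrite big_ord0 idE|apply/ffunP => -[]].
Qed.

End SimpleModule.

(** For the simple module at i the weighted sum of dimensions reduces to v_i. *)
Lemma regular_sincere (v : vert Q -> k) :
  regular_weight v -> forall i, v i != 0.
Proof.
move=> vr i; have fd : fin_dim (rep_mod (simple_rep i)).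
  pose e : rep_mod (simple_rep i) := (1 : k).
  apply: (fin_dim_fintype (b := fun _ : unit => e)) => m.
  exists (fun=> m : k); rewrite (bigD1 tt) //= big1 => [|[]//].
  by rewrite addr0 rep_algE -[RHS]/((m : k) * 1) mulr1.
have := vr _ fd (simple_indecomposable i) _ (simple_kdim i).
rewrite (bigD1 i) //= eqxx mulr1 big1 ?addr0 // => j /negPf ->.
by rewrite mulr0.
Qed.

End PathAlgebraTheory.

(** * The degree one part of a quotient of the path algebra of the double *)

Section DegreeOne.
Variables (k : fieldType) (Q : quiver).
Local Notation A := (path_alg k Q).
Local Notation D := (path_alg k (double Q)).
Local Notation fwd a := (arrow k (inl a : arr (double Q))).
Local Notation bwd a := (arrow k (inr a : arr (double Q))).

Lemma double_incl_arrow a : double_incl (arrow k a) = fwd a.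
Proof. by rewrite double_inclE; congr (pmon k _); apply: val_inj. Qed.

Lemma double_incl_idem (i : vert Q) :
  double_incl (idem k i) = idem k (i : vert (double Q)).
Proof. by rewrite double_inclE; congr (pmon k _); apply: val_inj. Qed.

Lemma pdeg0_incl p : pdeg p = 0%N -> exists b : A, pmon k p = double_incl b.
Proof.
case: p => -[i s]; rewrite /pdeg /parr /=; elim: s i => [|[a|a] s IH] i w //= e.
  exists (idem k (i : vert Q)); rewrite double_incl_idem.
  by congr (pmon k _); apply: val_inj.
have /andP[_ w'] := w; have [b bE] := IH _ w' e.
exists (arrow k a * b); rewrite (pmon_arrow_cons k w w') bE.
by rewrite rmorphM /= double_incl_arrow.
Qed.

(** The path contains exactly one reversed arrow. Hence the classes of the reversed arrows generate
    the degree one part as an A-bimodule. *)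
Lemma pdeg1_decomp p : pdeg p = 1%N -> exists (a b : A) c,
  pmon k p = double_incl a * bwd c * double_incl b.
Proof.
case: p => -[i s]; rewrite /pdeg /parr /=; elim: s i => [|[a|a] s IH] i w //= e.
  have /andP[_ w'] := w; have [b [c [d bE]]] := IH _ w' e.
  exists (arrow k a * b), c, d; rewrite (pmon_arrow_cons k w w') bE.
  by rewrite rmorphM /= double_incl_arrow !mulrA.
have /andP[_ w'] := w; case: e => e.
have [b bE] := @pdeg0_incl (@QPath (double Q) (_, _) w') e.
by exists 1, b, a; rewrite (pmon_arrow_cons k w w') bE rmorph1 mul1r.
Qed.

Section Tensor.
Variables (S : D -> Prop) (M : lmodType A).
Local Notation X1 := (piece_bimod S 1).

Fact star_subproof a : rq_pi S (bwd a) \in @piece_pred k Q S 1.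
Proof. by apply/asboolP; exists (bwd a) => //; exact: homog_pmon. Qed.

Definition star a : X1 := Piece (star_subproof a).

Definition tstar a (m : M) : tens X1 M := tmk (star a) m.

Lemma tmk0l (m : M) : tmk (0 : X1) m = 0.
Proof. by apply: (addrI (tmk (0 : X1) m)); rewrite -tmkDl !addr0. Qed.

Lemma tstar_klin a : klin (tstar a).
Proof.
move=> c x y; rewrite /tstar tmkDr -tmkA; congr (_ + _); rewrite -tmkZ.
congr tmk; apply: val_inj; rewrite /= -[_%:A]addr0 !linearP !raddf0 !addr0 /=.
rewrite -[in LHS]rmorphM -[in RHS]rmorphM !rmorph1.
by rewrite -scalerAr -scalerAl mulr1 mul1r.
Qed.

Lemma tstar_tail a (m : M) : tstar a (idem k (tail a) *: m) = tstar a m.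
Proof.
rewrite /tstar -tmkA; congr tmk; apply: val_inj => /=.
rewrite double_incl_idem -rmorphM; congr (rq_pi _ _).
exact: (arrow_head k (inr a : arr (double Q))).
Qed.

Lemma tstar_head a (m : M) : idem k (head a) *: tstar a m = tstar a m.
Proof.
rewrite /tstar -tmkZ; congr tmk; apply: val_inj => /=.
rewrite double_incl_idem -rmorphM; congr (rq_pi _ _).
exact: (tail_arrow k (inr a : arr (double Q))).
Qed.

(** The reversed arrows generate the degree one part as a bimodule, and factors from A on their
    right can be moved across the tensor sign. *)
Lemma tens_star_ind (P : tens X1 M -> Prop) :
  P 0 -> (forall a c m t, P t -> P (a *: tstar c m + t)) -> forall t, P t.
Proof.
move=> P0 PS; elim/lq_ind; elim/fm_ind => [|a [x m] f IH].
  by rewrite (_ : lq_pi _ 0 = 0) // linear0.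
rewrite linearP /= -/(tmk x m); move: (lq_pi _ f) IH => t Pt.
have /asboolP[y hy xy] := valP x.
(* Homogeneity of y is carried along, since the remainder of the sum must again define an element of
   the graded piece. *)
pose R y := y \in @homog k Q 1 /\ forall x : X1, val x = rq_pi S y ->
  forall a t, P t -> P (a *: tmk x m + t).
suff [_ /(_ x xy a t Pt)] : R y by [].
elim/homog_ind: hy {x xy a t Pt f} => [|c p f pd [hf Rf]].
  split=> [|x xE a t Pt]; first exact: rpred0.
  have -> : x = 0 by apply: val_inj; rewrite xE raddf0.
  by rewrite tmk0l scaler0 add0r.
have [a [b [d pE]]] := pdeg1_decomp pd; split=> [|x xE e t Pt].
  by rewrite rpredD // rpredZ // -pd homog_pmon.
have fp : rq_pi S f \in @piece_pred k Q S 1 by apply/asboolP; exists f.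
have -> : x = bm_act ((c *: a) *: star d) b + (Piece fp : X1).
  apply: val_inj; rewrite xE rmorphD /= pE; congr (_ + _).
  by rewrite linearZ /= !scalerAl !rmorphM.
rewrite tmkDl tmkA tmkZ scalerDr scalerA -addrA.
by apply: PS; apply: Rf.
Qed.

Lemma tens_star_ext (X : lmodType A) (g h : {linear tens X1 M -> X}) :
  (forall c m, g (tstar c m) = h (tstar c m)) -> g =1 h.
Proof.
move=> gh; elim/tens_star_ind => [|a c m t IH]; first by rewrite !linear0.
by rewrite !linearP gh IH.
Qed.

Lemma tens_fin_dim : acyclic Q -> fin_dim M -> fin_dim (tens X1 M).
Proof.
move=> ac /fin_dim_frame[B _].
pose b (ci : arr Q * 'I_(kdim B)) := tstar ci.1 (kvec B (delta_mx 0 ci.2)).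
apply: (fin_dim_gen (b := b) ac) => P P0 PP.
elim/tens_star_ind => // a c m t Pt; rewrite -[m](kcrdK B) kvecE /comb.
rewrite (klin_sum (@tstar_klin c)) scaler_sumr.
elim: (index_enum _) => [|i s IH]; first by rewrite big_nil add0r.
rewrite big_cons -addrA (klinZ (@tstar_klin c)) scalerA.
exact: (PP _ (c, i)).
Qed.

End Tensor.

Arguments tstar S {M} a m.
Arguments tmk0l S {M} m.

Section Lift.
Variables (S : D -> Prop) (M X : lmodType A) (phi : arr Q -> M -> X).
Hypothesis phik : forall a, klin (phi a).
Hypothesis phi_tail : forall a m, phi a (idem k (tail a) *: m) = phi a m.
Hypothesis phi_head : forall a m, idem k (head a) *: phi a m = phi a m.

Definition star_arr (a : arr (double Q)) (w : (kspace M * kspace X)%type) :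
    (kspace M * kspace X)%type :=
  match a with
  | inl a => (arrow k a *: (w.1 : M), arrow k a *: (w.2 : X))
  | inr a => (0, phi a w.1)
  end.

Definition star_vert (i : vert (double Q)) (w : (kspace M * kspace X)%type) :
    (kspace M * kspace X)%type :=
  (idem k (i : vert Q) *: (w.1 : M), idem k (i : vert Q) *: (w.2 : X)).

(** The double quiver acts on M (+) X: arrows of Q act diagonally, and a reversed arrow sends M to X
    by phi and kills X. Elements of degree one thus map M into X, which yields the morphism out of
    the tensor product. *)
Definition star_rep : rep k (double Q).
Proof.
refine (@Rep k (double Q) (kspace M * kspace X)%type star_vert star_arr
  _ _ _ _ _ _).
- by move=> i c [m x] [n y]; congr pair; apply: scale_klin.
- case=> a c [m x] [n y]; congr pair; rewrite /= ?scaler0 ?addr0 //.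
  + exact: scale_klin.
  + exact: scale_klin.
  + exact: phik.
- move=> i j [m x]; rewrite /star_vert /= !scalerA idemE.
  by case: eqP => // _; rewrite !scale0r.
- exact: kpair_idem1.
- case=> a [m x]; rewrite /star_vert /=.
    by rewrite !scalerA tail_arrow.
  by rewrite scaler0 phi_head.
- case=> a [m x]; rewrite /star_vert /=.
    by rewrite !scalerA arrow_head.
  by rewrite phi_tail.
Defined.

Local Notation W := (rep_mod star_rep).
Local Notation pr m x := ((m, x) : W).

Lemma star_fwd a (m : M) (x : X) :
  fwd a *: pr m x = pr (arrow k a *: m) (arrow k a *: x).
Proof. exact: rep_arrowE. Qed.

Lemma star_bwd a (m : M) (x : X) : bwd a *: pr m x = pr 0 (phi a m).
Proof. exact: rep_arrowE. Qed.

Lemma star_incl (a : A) (m : M) (x : X) :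
  double_incl a *: pr m x = pr (a *: m) (a *: x).
Proof.
elim/path_alg_gen: a m x => [|c a b IHa IHb|i|a b IH] m x.
- by rewrite linear0 !scale0r.
- rewrite linearP alg_smul IHa IHb rep_algE !alg_smul.
  by [].
- by rewrite double_incl_idem; exact: rep_idemE.
- by rewrite rmorphM /= double_incl_arrow -!scalerA IH star_fwd.
Qed.

Lemma star_homog1 y (m : M) (x : X) : y \in @homog k Q 1 ->
  y *: pr m x = pr 0 ((y *: pr m 0).2 : X).
Proof.
elim/homog_ind => [|c p f /pdeg1_decomp[a [b [d ->]]] IH].
  by rewrite !scale0r.
rewrite !alg_smul IH -!scalerA !star_incl !star_bwd !star_incl !rep_algE.
by congr pair; rewrite /= !scaler0 addr0.
Qed.

Hypothesis S0 : forall s, S s -> forall w : W, s *: w = 0.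

Lemma star_ideal y : y \in ideal S -> forall w : W, y *: w = 0.
Proof.
move=> /asboolP /(_ (fun y => `[< forall w : W, y *: w = 0 >])) h.
apply/asboolP; apply: h => [|a z b /asboolP z0|s /S0 s0]; last exact/asboolP.
  split=> [|y1 y2 /asboolP h1 /asboolP h2]; apply/asboolP => w.
    by rewrite scale0r.
  by rewrite scalerBl h1 h2 subrr.
by apply/asboolP => w; rewrite -!scalerA z0 scaler0.
Qed.

Definition star_pair (t : piece_bimod S 1) (m : M) : X :=
  ((repr (val t) : D) *: pr m 0).2.

Lemma star_pairE t y m : val t = rq_pi S y -> star_pair t m = (y *: pr m 0).2.
Proof.
move=> ty; rewrite /star_pair.
suff -> : (repr (val t) : D) *: pr m 0 = y *: pr m 0 by [].
apply/eqP; rewrite -subr_eq0 -scalerBl.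
by rewrite star_ideal // -rq_pi_eq rq_reprK ty.
Qed.

Lemma star_pair_reprP (t : piece_bimod S 1) :
  exists2 y, y \in @homog k Q 1 & val t = rq_pi S y.
Proof. exact/asboolP/(valP t). Qed.

Fact star_pair_rel s : @tens_rel A (piece_bimod S 1) M s ->
  @lext A (piece_bimod S 1 * M)%type X (fun tm => star_pair tm.1 tm.2) s = 0.
Proof.
case=> [t u m|t m n|t a m|a t m]; rewrite !linearB ?linearZ /= !lextU /=.
- have [y _ ty] := star_pair_reprP t; have [z _ uz] := star_pair_reprP u.
  rewrite (star_pairE _ ty) (star_pairE _ uz) (@star_pairE _ (y + z)).
    by rewrite scalerDl /= addrAC addrK subrr.
  by rewrite /= ty uz rmorphD.
- have [y _ ty] := star_pair_reprP t; rewrite !(star_pairE _ ty).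
  have -> : pr (m + n) 0 = pr m 0 + pr n 0 by congr pair; rewrite addr0.
  by rewrite scalerDr /= addrAC addrK subrr.
- have [y _ ty] := star_pair_reprP t; rewrite (star_pairE _ ty).
  rewrite (@star_pairE _ (y * double_incl a)); last by rewrite /= ty rmorphM.
  by rewrite -scalerA star_incl scaler0 subrr.
- have [y yh ty] := star_pair_reprP t; rewrite (star_pairE _ ty).
  rewrite (@star_pairE _ (double_incl a * y)); last by rewrite /= ty rmorphM.
  by rewrite -scalerA star_homog1 // star_incl /= scalerN subrr.
Qed.

(** The morphism sends t (x) m to the X-component of t (m, 0). This is well defined because the
    annihilator of M (+) X is an ideal containing the relations. *)
Lemma tens_star_lift : exists w : {linear tens (piece_bimod S 1) M -> X},
  forall a m, w (tstar S a m) = phi a m.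
Proof.
exists (lq_map star_pair_rel) => a m.
apply: etrans (lq_mapE star_pair_rel _) _; apply: etrans (lextU _ _) _ => /=.
by rewrite (@star_pairE _ (bwd a)) // star_bwd.
Qed.

End Lift.
End DegreeOne.

Arguments tstar {k Q} S {M} a m.
Arguments tmk0l {k Q} S {M} m.

(** * Exactness *)

Section Sequence.
Variables (k : fieldType) (Q : quiver).
Local Notation A := (path_alg k Q).
Local Notation D := (path_alg k (double Q)).
Local Notation fwd a := (arrow k (inl a : arr (double Q))).
Local Notation bwd a := (arrow k (inr a : arr (double Q))).

(** The sum of all rho_i. Cutting it by the idempotent at i recovers rho_i, and multiplying it by
    v^-1 gives the weighted element. *)
Definition star_comm : D := \sum_a (fwd a * bwd a - bwd a * fwd a).

Lemma idem_star_comm (i : vert Q) :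
  idem k (i : vert (double Q)) * star_comm = rho k i.
Proof.
rewrite /star_comm mulr_sumr; under eq_bigr => a _ do rewrite mulrBr !idemM.
rewrite sumrB -!big_mkcond /=.
by congr (_ - _); apply: eq_bigl => a; rewrite eq_sym.
Qed.

Lemma sum_rho : \sum_(i : vert Q) rho k i = star_comm.
Proof.
rewrite -[RHS]mul1r -sum_idem mulr_suml.
by apply: eq_bigr => i _; rewrite idem_star_comm.
Qed.

Lemma wrhoE v :
  wrho v = double_incl (weight_elt (fun i => (v i)^-1)) * star_comm.
Proof.
rewrite /wrho /weight_elt linear_sum mulr_suml; apply: eq_bigr => i _.
by rewrite linearZ /= double_incl_idem -scalerAl idem_star_comm.
Qed.

Section Delta.
Variables (M X : lmodType A) (phi : arr Q -> M -> X).

Definition delta (m : M) : X :=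
  \sum_a (arrow k a *: phi a m - phi a (arrow k a *: m)).

End Delta.

Section StarDelta.
Variables (S : D -> Prop) (M : lmodType A).

Fact star_comm_subproof : rq_pi S star_comm \in @piece_pred k Q S 1.
Proof.
apply/asboolP; exists star_comm => //; rewrite -sum_rho.
by apply: rpred_sum => i _; exact: rho_homog.
Qed.

(** Moving arrows across the tensor sign turns (a a^* - a^* a) (x) m into a (a^* (x) m) - a^* (x) a
    m. *)
Lemma delta_tstar (m : M) :
  delta (tstar S) m = tmk (Piece star_comm_subproof : piece_bimod S 1) m.
Proof.
have -> : (Piece star_comm_subproof : piece_bimod S 1) =
    \sum_a (arrow k a *: star S a - bm_act (star S a) (arrow k a)).
  apply: val_inj; rewrite [RHS]raddf_sum -[LHS]/(rq_pi S star_comm) raddf_sum.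
  apply: eq_bigr => a _.
  by rewrite raddfB /= !rmorphM /= double_incl_arrow.
have tD : {morph (fun t : piece_bimod S 1 => tmk t m) : x y / x + y}.
  by move=> x y; exact: tmkDl.
rewrite [RHS](big_morph _ tD (tmk0l S m)); apply: eq_bigr => a _.
have tN (x : piece_bimod S 1) : tmk (- x) m = - tmk x m.
  by apply: (addrI (tmk x m)); rewrite -tmkDl !subrr tmk0l.
by rewrite tmkDl tN tmkZ tmkA.
Qed.

End StarDelta.

Section Lifts.
Variables (M X : lmodType A) (phi : arr Q -> M -> X).
Hypothesis phik : forall a, klin (phi a).
Hypothesis phi_tail : forall a m, phi a (idem k (tail a) *: m) = phi a m.
Hypothesis phi_head : forall a m, idem k (head a) *: phi a m = phi a m.

Local Notation W := (rep_mod (star_rep phik phi_tail phi_head)).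
Local Notation pr m x := ((m, x) : W).

Lemma star_comm_act (m : M) (x : X) : star_comm *: pr m x = pr 0 (delta phi m).
Proof.
rewrite /star_comm scaler_suml /delta.
transitivity (\sum_a pr 0 (arrow k a *: phi a m - phi a (arrow k a *: m))).
  apply: eq_bigr => a _; rewrite scalerBl -!scalerA star_bwd !star_fwd star_bwd.
  by congr pair; rewrite /= scaler0 subr0.
have pD : {morph (fun y : X => pr 0 y) : y z / y + z}.
  by move=> y z; congr pair; rewrite addr0.
by rewrite [RHS](big_morph _ pD erefl).
Qed.

Lemma preproj_lift : (forall m, delta phi m = 0) ->
  exists w : {linear tens (preprojective_deg k Q 1) M -> X},
    forall a m, w (tstar (@preproj_rel k Q) a m) = phi a m.
Proof.
move=> d0; apply: (@tens_star_lift k Q (@preproj_rel k Q) M X phi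
  phik phi_tail phi_head) => _ [i ->] [m x].
by rewrite -idem_star_comm -scalerA star_comm_act d0 scaler0.
Qed.

(** The weighted element acts on M (+) X by (m, x) |-> (0, u m). It commutes with the arrows of Q as
    u is A-linear, and its products with reversed arrows in either order vanish, so the relations
    act by zero. *)
Lemma heis_lift v (u : {linear M -> X}) :
  (forall m, weight_elt (fun i => (v i)^-1) *: delta phi m = u m) ->
  exists w : {linear tens (heisenberg_deg v 1) M -> X},
    forall a m, w (tstar (heisenberg_rel v) a m) = phi a m.
Proof.
move=> du; apply: (@tens_star_lift k Q (heisenberg_rel v) M X phi
  phik phi_tail phi_head).
have act m x : wrho v *: pr m x = pr 0 (u m).
  by rewrite wrhoE -scalerA star_comm_act star_incl du scaler0.
move=> _ [a ->] [m x]; rewrite /weta scalerBl -!scalerA act.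
apply/eqP; rewrite subr_eq0; apply/eqP.
case: a => a; first by rewrite !star_fwd act linearZ scaler0.
by rewrite !star_bwd act (klin0 (phik a)) linear0.
Qed.

End Lifts.

(** * The maps of the sequence and their exactness *)

Section Exactness.
Variables (v : vert Q -> k) (M : lmodType A).
Local Notation F := (wrho_mod v M).
Local Notation G := (proj_mod v M).
Local Notation hstar := (tstar (heisenberg_rel v)).
Local Notation pstar := (tstar (@preproj_rel k Q)).

Lemma wrho_modE (m : M) :
  F m = weight_elt (fun i => (v i)^-1) *: delta hstar m.
Proof.
rewrite delta_tstar -tmkZ; apply: etrans (tens_mapE _ _ _) _.
congr tmk; rewrite /= /wrho_map scale1r; apply: val_inj => /=.
by rewrite wrhoE rmorphM.
Qed.

Lemma proj_mod_star a (m : M) : G (hstar a m) = pstar a m.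
Proof.
apply: etrans (tens_mapE _ _ _) _; congr tmk; apply: val_inj => /=.
exact: heis_projE.
Qed.

Lemma delta_pstar (m : M) : delta pstar m = 0.
Proof.
rewrite delta_tstar -[RHS](tmk0l (@preproj_rel k Q) m); congr tmk.
apply: val_inj => /=; apply/eqP; rewrite -(rmorph0 (rq_pi _)) rq_pi_eq subr0.
by rewrite -sum_rho rpred_sum // => i _; apply: ideal_sub; exists i.
Qed.

Lemma linear_delta (X Y : lmodType A) (h : {linear X -> Y})
    (phi : arr Q -> M -> X) m :
  h (delta phi m) = delta (fun a x => h (phi a x)) m.
Proof.
rewrite linear_sum; apply: eq_bigr => a _.
by rewrite linearB linearZ.
Qed.

Lemma proj_wrho (m : M) : G (F m) = 0.
Proof.
rewrite wrho_modE linearZ linear_delta /= (_ : (fun _ _ => _) = pstar).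
  by rewrite delta_pstar scaler0.
by apply: funext => a; apply: funext => x; rewrite proj_mod_star.
Qed.

Lemma proj_mod_surj t : exists e, G e = t.
Proof.
elim/tens_star_ind: t => [|a c m t [e <-]]; first by exists 0; rewrite linear0.
by exists (a *: hstar c m + e); rewrite linearP proj_mod_star.
Qed.

Hypothesis v0 : forall i, v i != 0.

Lemma delta_hstar (m : M) : delta hstar m = F (weight_elt v *: m).
Proof.
rewrite [RHS]linearZ_LR wrho_modE scalerA.
(* The product needed is v v^-1, so [weight_invK] is applied to the inverse weight. *)
have -> : v = (fun i => (v i)^-1^-1) by apply: funext => i; rewrite invrK.
have e : (fun i => (v i)^-1^-1^-1) = (fun i => (v i)^-1).
  by apply: funext => i; rewrite invrK.
by rewrite e weight_invK ?scale1r // => i; rewrite invr_eq0.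
Qed.

(** In the cokernel of [F] the classes of a^* (x) m satisfy delta = 0, so they define a morphism
    from Pi_1 (x) M. The projection onto the cokernel therefore factors through [G]. *)
Lemma ker_proj_mod e : G e = 0 -> exists m, F m = e.
Proof.
pose S s := exists m, F m = s.
pose phi a (m : M) : lquot S := lq_pi S (hstar a m).
have SE s : s \in span S -> S s.
  apply: span_id => [|a x y [m <-] [n <-]]; first by exists 0; rewrite linear0.
  by exists (a *: m + n); rewrite linearP.
have [|||m|w wE] := @preproj_lift M (lquot S) phi.
- by move=> a c x y; rewrite /phi tstar_klin linearP.
- by move=> a m; rewrite /phi tstar_tail.
- by move=> a m; rewrite /phi -linearZ /= tstar_head.
- rewrite -linear_delta delta_hstar /=; apply/eqP; rewrite lq_pi_eq0.
  by apply: span_sub; exists (weight_elt v *: m).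
have wG : (w \o G) =1 lq_pi S.
  by apply: tens_star_ext => a m; rewrite /= proj_mod_star wE.
move=> e0; apply: SE; have := wG e; rewrite /= e0 linear0 => /esym/eqP.
by rewrite lq_pi_eq0.
Qed.

End Exactness.
End Sequence.

(** * The left almost split property *)

Section LeftAlmostSplit.
Variables (k : fieldType) (Q : quiver).
Local Notation A := (path_alg k Q).

Section Truncation.
Variables (M X : lmodType A) (phi : arr Q -> M -> X).
Hypothesis phik : forall a, klin (phi a).

(** The component of phi_a from M_t to X_h. It turns any family of k-linear maps into one that is
    compatible with the vertices. *)
Definition trunc a (m : M) : X :=
  idem k (head a) *: phi a (idem k (tail a) *: m).

Lemma trunc_klin a : klin (trunc a).
Proof.
by apply: klin_scale; apply: (klin_comp (phik a)); exact: scale_klin.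
Qed.

Lemma trunc_tail a m : trunc a (idem k (tail a) *: m) = trunc a m.
Proof. by rewrite /trunc scalerA idemE eqxx. Qed.

Lemma trunc_head a m : idem k (head a) *: trunc a m = trunc a m.
Proof. by rewrite /trunc scalerA idemE eqxx. Qed.

End Truncation.

(** Each commutator of a with phi_a has trace zero. *)
Lemma ktr_delta (M : lmodType A) (B : kframe M) (phi : arr Q -> M -> M) :
  (forall a, klin (phi a)) -> ktr B (delta phi) = 0.
Proof.
move=> phik; rewrite /delta ktr_sum big1 // => a _.
by rewrite ktrB (ktrC B B (scale_klin _) (phik a)) subrr.
Qed.

Section Duality.
Variables (v : vert Q -> k) (M X : lmodType A) (B : kframe M) (C : kframe X).

(* A functional psi on Hom_k(M, X) killing the image of delta satisfies
   e_t psi a = a psi e_h for every arrow a, so that its vertexwise diagonal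
   part is a morphism of modules. *)
Lemma delta_image (u : {linear M -> X}) :
  (forall psi : {linear X -> M},
     ktr B (fun m => weight_elt v *: psi (u m)) = 0) ->
  exists2 phi : arr Q -> M -> X, forall a, klin (phi a)
    & forall m, delta (trunc phi) m = u (weight_elt v *: m).
Proof.
move=> utr.
pose K (f : unit -> M -> X) := exists2 phi : arr Q -> M -> X,
  forall a, klin (phi a) & forall m, delta (trunc phi) m = f tt m.
have [//|nK] := pselect (K (fun _ m => u (weight_elt v *: m))).
have [|c f g [p pk pE] [q qk qE]|_|ct [ck c0 c1]] := kseparate B C _ _ _ nK.
- exists (fun _ _ => 0) => [a|m]; first exact: klin_zero.
  by rewrite /delta big1 // => a _; rewrite /trunc !scaler0 subrr.
- exists (fun a m => c%:A *: p a m + q a m) => [a|m].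
    by apply: klin_add => //; apply: klin_scale.
  have tE a y : trunc (fun a m => c%:A *: p a m + q a m) a y =
      c%:A *: trunc p a y + trunc q a y by rewrite /trunc scalerDr kscaleC.
  rewrite -pE -qE /delta (@scaler_sumr A X c%:A) -big_split.
  apply: eq_bigr => a _ /=.
  by rewrite !tE scalerBr scalerDr kscaleC opprD addrACA.
- by apply: klin_comp; [exact: linear_klin|exact: scale_klin].
have {ck} dk := ck tt; set d := ct tt in dk c0 c1.
move: c1; rewrite (bigD1 tt) //= big1 ?addr0 => [|[]//]; rewrite -/d => c1.
have dE (f : M -> X) : klin f -> K (fun=> f) -> ktr B (fun m => d (f m)) = 0.
  by move=> fk /c0 <- //; rewrite (bigD1 tt) //= big1 ?addr0 // => -[].
(* Nondegeneracy of the trace is applied to families concentrated at the single arrow a. *)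
have key a x : idem k (tail a) *: d (arrow k a *: x) =
               arrow k a *: d (idem k (head a) *: x).
  have lk : klin (fun x => idem k (tail a) *: d (arrow k a *: x)).
    by apply: klin_scale; apply: (klin_comp dk); exact: scale_klin.
  have rk : klin (fun x => arrow k a *: d (idem k (head a) *: x)).
    by apply: klin_scale; apply: (klin_comp dk); exact: scale_klin.
  apply/eqP; rewrite -subr_eq0; apply/eqP.
  apply: (ktr_nondeg (B := B) C (klin_sub lk rk)) => p pk.
  pose q b := if b == a then p else fun=> 0.
  have qk b : klin (q b) by rewrite /q; case: ifP => // _; exact: klin_zero.
  have qE : delta (trunc q) =1 fun m => arrow k a *: p (idem k (tail a) *: m)
                                        - idem k (head a) *: p (arrow k a *: m).
    move=> m; rewrite /delta (bigD1 a) //= big1 ?addr0 => [|b /negPf ba].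
      by rewrite /trunc /q eqxx !scalerA arrow_head tail_arrow.
    by rewrite /trunc /q ba !scaler0 subrr.
  rewrite ktrB (ktrC B B (scale_klin (idem k (tail a)))); last first.
    by apply: (klin_comp dk); apply: klin_scale.
  rewrite (ktrC B B (scale_klin (arrow k a))); last first.
    by apply: (klin_comp dk); apply: klin_scale.
  rewrite -ktrB -[RHS](dE (delta (trunc q))).
  - by apply: eq_ktr => m; rewrite qE (klinB dk).
  - apply: klin_bigsum => b; apply: klin_sub.
      by apply: klin_scale; exact: trunc_klin.
    by apply: klin_comp; [exact: trunc_klin|exact: scale_klin].
  - by exists q.
(* The vertexwise diagonal part of d; by [key] it commutes with the arrows. *)
pose h x := \sum_i idem k i *: d (idem k i *: x).
have hk : klin h.
  apply: klin_bigsum => i; apply: klin_scale; apply: (klin_comp dk).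
  exact: scale_klin.
have hi j x : h (idem k j *: x) = idem k j *: d (idem k j *: x).
  rewrite /h (bigD1 j) //= big1 ?addr0 => [|i /negPf ij].
    by rewrite [idem k j *: (_ *: _)]scalerA idemE eqxx.
  by rewrite [idem k i *: (_ *: _)]scalerA idemE ij scale0r (klin0 dk) scaler0.
have ih j x : idem k j *: h x = idem k j *: d (idem k j *: x).
  rewrite /h scaler_sumr (bigD1 j) //= big1 ?addr0 => [|i /negPf ij].
    by rewrite scalerA idemE eqxx.
  by rewrite scalerA idemE eq_sym ij scale0r.
have hl : linear h.
  apply: klin_linear => // [i x|a x]; first by rewrite hi ih.
  rewrite -[in LHS]tail_arrow -scalerA hi [in LHS]scalerA tail_arrow key.
  by rewrite -[in RHS]arrow_head -[RHS]scalerA ih scalerA arrow_head.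
have [psi psiE] := linear_pack hl.
case/eqP: c1; rewrite -[RHS](utr psi).
transitivity (\sum_i ktr B (fun m =>
    weight_elt v *: (idem k i *: d (idem k i *: u m)))); last first.
  rewrite -ktr_sum; apply: eq_ktr => m; rewrite psiE /h.
  by rewrite scaler_sumr.
transitivity (\sum_i ktr B (fun m => d (u (v i *: idem k i *: m)))).
  rewrite -ktr_sum; apply: eq_ktr => m.
  by rewrite -(klin_sum dk) -linear_sum -scaler_suml.
apply: eq_bigr => i _; symmetry; under eq_ktr => m do rewrite scalerA.
rewrite (ktrC B B (scale_klin _)); last first.
  by apply: (klin_comp dk); apply: klin_scale; exact: linear_klin.
apply: eq_ktr => m; rewrite -linearZ /= scalerA mulrA idem_weight.
by rewrite -scalerAl idemE eqxx.
Qed.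

End Duality.

Section Extension.
Variables (v : vert Q -> k) (M : lmodType A) (B : kframe M).
Hypothesis v0 : forall i, v i != 0.

Lemma wrho_mod_extend (X : lmodType A) (u : {linear M -> X}) : fin_dim X ->
  (forall psi : {linear X -> M},
     ktr B (fun m => weight_elt v *: psi (u m)) = 0) ->
  exists w : {linear tens (heisenberg_deg v 1) M -> X},
    forall m, w (wrho_mod v M m) = u m.
Proof.
move=> /fin_dim_frame[C _] /(delta_image C)[phi phik phiE].
have uE m : weight_elt (fun i => (v i)^-1) *: delta (trunc phi) m = u m.
  by rewrite phiE -linearZ /= scalerA weight_invK // scale1r.
have [w wE] := heis_lift (trunc_klin phik) (trunc_tail phi) (trunc_head phi) uE.
exists w => m; rewrite wrho_modE linearZ linear_delta -uE /=.
congr (_ *: delta _ m); apply: funext => a; apply: funext => x; exact: wE.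
Qed.

(** By Fitting psi u is bijective or nilpotent, and in the first case u would split. The action of v
    commutes with psi u, so their product is nilpotent too. *)
Lemma ktr_not_split_mono (X : lmodType A) (u : {linear M -> X})
    (psi : {linear X -> M}) : indecomposable M -> ~ split_mono u ->
  ktr B (fun m => weight_elt v *: psi (u m)) = 0.
Proof.
move=> Mi us; have [|[n nil]] := fitting (psi \o u) (frame_fin_dim B) Mi.
  move=> /bij_linear_inv[g [gK _]]; case: us; exists (g \o psi).
  exact: gK.
apply: (@ktr_nilpotent _ _ _ _ _ n) => [|m].
  by apply: klin_scale; apply: linear_klin (psi \o u).
have -> : iter n (fun m => weight_elt v *: psi (u m)) m =
    weight_elt v ^+ n *: iter n (psi \o u) m.
  elim: (n) => [|j IH]; first by rewrite expr0 scale1r.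
  by rewrite !iterS IH /= !linearZ /= scalerA exprS.
by rewrite nil scaler0.
Qed.

(** Applying a retraction to [delta_hstar] writes the action of v on M as some delta(phi), which has
    trace zero, against regularity. *)
Lemma wrho_mod_not_split : regular_weight v -> indecomposable M ->
  ~ split_mono (wrho_mod v M).
Proof.
move=> vr Mi [r rF]; have /eqP := ktr_weight B vr Mi; apply.
rewrite -[RHS](@ktr_delta M B (fun a m => r (tstar (heisenberg_rel v) a m))).
  by apply: eq_ktr => m; rewrite -[LHS]rF -delta_hstar // linear_delta.
by move=> a; apply: klin_comp; [exact: linear_klin|exact: tstar_klin].
Qed.

(* Otherwise M would be a direct summand of every finite-dimensional module
   containing it, in particular of pushouts. *)
Lemma wrho_mod_inj : regular_weight v -> indecomposable M ->
  ~ injective_module M -> injective (wrho_mod v M).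
Proof.
move=> vr Mi Mni; apply: contrapT => Fni; apply: Mni => X Y fX fY j ji g.
(* The quotient of M x Y by these elements is the pushout of g and j. *)
pose S (s : (M * Y)%type) := exists x, s = (g x, - j x).
have SE s : s \in span S -> S s.
  apply: span_id => [|a s1 s2 [x ->] [y ->]].
    by exists 0; rewrite !linear0.
  exists (a *: x + y); rewrite !linearP.
  by congr pair; rewrite /= opprD scalerN.
pose i m : lquot S := lq_pi S (m, 0).
have il : linear i.
  move=> a x y; rewrite /i -linearP; congr (lq_pi S (_, _)).
  by rewrite /= scaler0 addr0.
have [I IE] := linear_pack il.
(* A retraction of M -> pushout restricts to Y as the required extension of g. *)
have [[r rI]|nI] := pselect (split_mono I).
  have hl : linear (fun y => r (lq_pi S (0, y))).
    move=> a x y; rewrite -linearP -linearP; congr (r (lq_pi S (_, _))).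
    by rewrite /= scaler0 addr0.
  have [h hE] := linear_pack hl; exists h => x; rewrite hE -[RHS]rI IE.
  congr (r _); apply/eqP; rewrite lq_pi_eq span_sub //; exists (- x).
  by rewrite !linearN opprK; congr pair; rewrite /= ?add0r ?subr0.
have fP : fin_dim (lquot S).
  apply: (fin_dim_surj (linear_klin (lq_pi S))); last first.
    by apply: fin_dim_prod fY; exact: frame_fin_dim B.
  by elim/lq_ind => s; exists s.
(* Otherwise M -> pushout factors through [wrho_mod]. It is injective because j is, so [wrho_mod] is
   injective as well. *)
have [w wF] := wrho_mod_extend fP (fun psi => ktr_not_split_mono psi Mi nI).
case: Fni => x y /(congr1 w); rewrite !wF !IE => /eqP.
rewrite lq_pi_eq => /SE[z [xy /esym/eqP]]; rewrite subrr oppr_eq0 => /eqP jz.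
apply/eqP; rewrite -subr_eq0 xy (_ : z = 0) ?linear0 //.
by apply: ji; rewrite linear0.
Qed.

End Extension.
End LeftAlmostSplit.

(** * The right almost split property *)

Section Factor.
Variables (k : fieldType) (A : algType k).

Lemma klin_factor (E N X : lmodType A) (g : {linear E -> N}) (h : E -> X) :
  (forall n, exists e, g e = n) -> klin h -> (forall e, g e = 0 -> h e = 0) ->
  exists2 s : N -> X, klin s & forall e, s (g e) = h e.
Proof.
move=> /choice[sec secK] hk hg.
have sE e : h (sec (g e)) = h e.
  apply/eqP; rewrite -subr_eq0 -(klinB hk); apply/eqP/hg.
  by rewrite linearB secK subrr.
exists (h \o sec) => [c x y|e]; last exact: sE.
by rewrite -[x]secK -[y]secK -linearP /= !sE hk.
Qed.

Lemma linear_factor (E N X : lmodType A) (g : {linear E -> N})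
    (h : {linear E -> X}) :
  (forall n, exists e, g e = n) -> (forall e, g e = 0 -> h e = 0) ->
  exists s : {linear N -> X}, forall e, s (g e) = h e.
Proof.
move=> gs hg; have [s _ sE] := klin_factor gs (linear_klin h) hg.
have sl : linear s.
  move=> a x y; have [e <-] := gs x; have [f <-] := gs y.
  by rewrite -linearP !sE linearP.
by have [t tE] := linear_pack sl; exists t => e; rewrite tE.
Qed.

Lemma split_epi_mono (M E N : lmodType A) (f : {linear M -> E})
    (g : {linear E -> N}) : short_exact f g -> split_epi g -> split_mono f.
Proof.
move=> [fi _ fg] [s gs].
have /choice[r rE] e : exists m, f m = e - s (g e).
  by apply/fg; rewrite linearB gs subrr.
have rl : linear r.
  move=> a x y; apply: fi; rewrite (linearP f) !rE (linearP g) (linearP s).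
  by rewrite scalerBr opprD addrACA.
have [t tE] := linear_pack rl; exists t => m; rewrite tE; apply: fi; rewrite rE.
have -> : g (f m) = 0 by apply/fg; exists m.
by rewrite linear0 subr0.
Qed.

End Factor.

(** * Extensions of X by M defined by cocycles *)

Section Extensions.
Variables (k : fieldType) (Q : quiver).
Local Notation A := (path_alg k Q).
Variables (M X : lmodType A) (c : arr Q -> X -> M).
Hypothesis ck : forall a, klin (c a).
Hypothesis c_tail : forall a x, idem k (tail a) *: c a x = c a x.
Hypothesis c_head : forall a x, c a (idem k (head a) *: x) = c a x.

(** The arrow a acts by an upper triangular block matrix with corner c_a. A path algebra imposes no
    relations between arrows, so every family compatible with the vertices is a cocycle. *)
Definition ext_rep : rep k Q.
Proof.
refine (@Rep k Q (kspace M * kspace X)%type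
  (fun i w => (idem k i *: (w.1 : M), idem k i *: (w.2 : X)))
  (fun a w => (arrow k a *: (w.1 : M) + c a w.2, arrow k a *: (w.2 : X)))
  _ _ _ _ _ _).
- by move=> i d [m x] [n y]; congr pair; apply: scale_klin.
- move=> a d [m x] [n y]; congr pair; last exact: scale_klin.
  by rewrite /= (scale_klin (arrow k a)) ck scalerDr addrACA.
- move=> i j [m x]; rewrite /= !scalerA idemE.
  by case: eqP => // _; rewrite !scale0r.
- exact: kpair_idem1.
- by move=> a [m x]; rewrite /= scalerDr !scalerA tail_arrow c_tail.
- by move=> a [m x]; rewrite /= !scalerA arrow_head c_head.
Defined.

Local Notation F := (rep_mod ext_rep).

Lemma ext_arrow a (m : M) (x : X) :
  arrow k a *: ((m, x) : F) = (arrow k a *: m + c a x, arrow k a *: x).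
Proof. exact: rep_arrowE. Qed.

Lemma ext_idem i (m : M) (x : X) :
  idem k i *: ((m, x) : F) = (idem k i *: m, idem k i *: x).
Proof. exact: rep_idemE. Qed.

Lemma ext_fin_dim : fin_dim M -> fin_dim X -> fin_dim F.
Proof.
move=> fM fX.
apply: (@fin_dim_surj k A (M * X)%type F id _ _ (fin_dim_prod fM fX)).
  by move=> d w w'; rewrite rep_algE.
by move=> w; exists w.
Qed.

Lemma ext_incl : exists f : {linear M -> F}, forall m, f m = (m, 0).
Proof.
suff fl : linear (fun m : M => (m, 0) : F).
  by have [f fE] := linear_pack fl; exists f.
apply: klin_linear => [d x y|i m|a m].
- by rewrite rep_algE; congr pair; rewrite /= scaler0 addr0.
- by rewrite ext_idem scaler0.
- by rewrite ext_arrow scaler0 (klin0 (ck a)) addr0.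
Qed.

Lemma ext_proj : exists f : {linear F -> X}, forall w, f w = w.2.
Proof.
suff fl : linear (fun w : F => w.2 : X).
  by have [f fE] := linear_pack fl; exists f.
apply: klin_linear => [d [m x] [n y]|i [m x]|a [m x]].
- by rewrite rep_algE.
- by rewrite ext_idem.
- by rewrite ext_arrow.
Qed.

Lemma ext_fst_klin : klin (fun w : F => w.1 : M).
Proof. by move=> d [m x] [n y]; rewrite rep_algE. Qed.

Lemma ext_snd_klin : klin (fun x : X => (0, x) : F).
Proof.
by move=> d x y; rewrite rep_algE; congr pair; rewrite /= scaler0 addr0.
Qed.

End Extensions.

(** * From left to right almost split *)

Section RightAlmostSplit.
Variables (k : fieldType) (Q : quiver).
Local Notation A := (path_alg k Q).
Variables (M E N : lmodType A) (f : {linear M -> E}) (g : {linear E -> N}).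
Variables (hstar : arr Q -> M -> E) (wt : A).
Variables (BM : kframe M) (BN : kframe N).
Hypothesis E_fd : fin_dim E.
Hypothesis fg_exact : short_exact f g.
Hypothesis f_left : left_almost_split f.
Hypothesis hstar_klin : forall a, klin (hstar a).
Hypothesis hstar_tail : forall a m, hstar a (idem k (tail a) *: m) = hstar a m.
Hypothesis hstar_head : forall a m, idem k (head a) *: hstar a m = hstar a m.
Hypothesis delta_hstarE : forall m, delta hstar m = f (wt *: m).
Hypothesis ktr_wt : ktr BM (fun m => wt *: m) != 0.
Hypothesis gstar_ext : forall s t : {linear N -> N},
  (forall a m, s (g (hstar a m)) = t (g (hstar a m))) -> s =1 t.

Let f_inj : injective f. Proof. by case: fg_exact. Qed.
Let g_surj n : exists e, g e = n. Proof. by case: fg_exact. Qed.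
Let gf m : g (f m) = 0.
Proof. by case: fg_exact => _ _ fg; apply/fg; exists m. Qed.
Let ker_g e : g e = 0 -> exists m, f m = e.
Proof. by case: fg_exact => _ _ fg /fg. Qed.

Let gstar a m := g (hstar a m).

Let gstar_klin a : klin (gstar a).
Proof. by apply: klin_comp; first exact: linear_klin. Qed.

Lemma delta_gstar m : delta gstar m = 0.
Proof. by rewrite /gstar -linear_delta delta_hstarE gf. Qed.

(** A k-linear retraction of f is replaced by the sum of its blocks e_i r e_i; only the arrows can
    then obstruct A-linearity. *)
Lemma equivariant_retraction : exists r : E -> M, [/\ klin r,
  forall i e, r (idem k i *: e) = idem k i *: r e & forall m, r (f m) = m].
Proof.
have [BE _] := fin_dim_frame E_fd.
have [r rk rf] := klin_retraction BM BE (linear_klin f) f_inj.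
exists (fun e => \sum_i idem k i *: r (idem k i *: e)); split=> [|j e|m].
- apply: klin_bigsum => i; apply: klin_scale; apply: (klin_comp rk).
  exact: scale_klin.
- rewrite scaler_sumr; apply: eq_bigr => i _.
  rewrite !scalerA !idemE eq_sym; case: (eqVneq i j) => [->//|_].
  by rewrite !scale0r (klin0 rk) scaler0.
- rewrite -[RHS](sum_idem_scale m); apply: eq_bigr => i _.
  by rewrite -linearZ rf scalerA idemE eqxx.
Qed.

Variable r : E -> M.
Hypothesis rk : klin r.
Hypothesis r_idem : forall i e, r (idem k i *: e) = idem k i *: r e.
Hypothesis rf : forall m, r (f m) = m.

(** The failure of r to commute with a vanishes on the image of f, hence descends to N. This cocycle
    represents the class of the sequence in Ext^1(N, M). *)
Lemma cocycle_exists : exists eps : arr Q -> N -> M, forall a, klin (eps a) /\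
  forall e, eps a (g e) = r (arrow k a *: e) - arrow k a *: r e.
Proof.
suff /choice[eps epsP] : forall a, exists ea : N -> M, klin ea /\
    forall e, ea (g e) = r (arrow k a *: e) - arrow k a *: r e by exists eps.
move=> a; have [||s sk sE] := klin_factor g_surj
    (h := fun e => r (arrow k a *: e) - arrow k a *: r e).
- apply: klin_sub; first by apply: (klin_comp rk); exact: scale_klin.
  exact: klin_scale.
- by move=> _ /ker_g[m <-]; rewrite -linearZ !rf subrr.
- by exists s.
Qed.

Lemma pairing_coboundary (X : lmodType A) (h : {linear N -> X}) (z : X -> M) :
  klin z ->
  \sum_a ktr BM (fun m => z (arrow k a *: h (gstar a m)) -
                          arrow k a *: z (h (gstar a m))) = 0.
Proof.
move=> zk.
have hgk a : klin (fun m => z (h (gstar a m))).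
  by apply: (klin_comp zk); apply: (klin_comp (linear_klin h)).
transitivity (\sum_a ktr BM (fun m => z (h (arrow k a *: gstar a m)) -
                                      z (h (gstar a (arrow k a *: m))))).
  apply: eq_bigr => a _; rewrite !ktrB; congr (_ - _).
    by apply: eq_ktr => m; rewrite linearZ.
  by rewrite (ktrC BM BM (scale_klin (arrow k a)) (hgk a)).
rewrite -ktr_sum -[RHS](ktr0 BM); apply: eq_ktr => m.
rewrite -[RHS](klin0 zk) -[in RHS](linear0 h) -(delta_gstar m) /delta.
rewrite linear_sum (klin_sum zk); apply: eq_bigr => a _.
by rewrite linearB (klinB zk).
Qed.

Variable eps : arr Q -> N -> M.
Hypothesis eps_klin : forall a, klin (eps a).
Hypothesis epsE : forall a e,
  eps a (g e) = r (arrow k a *: e) - arrow k a *: r e.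

Lemma cocycle_tail a n : idem k (tail a) *: eps a n = eps a n.
Proof.
have [e <-] := g_surj n; rewrite epsE scalerBr scalerA tail_arrow.
by rewrite -r_idem scalerA tail_arrow.
Qed.

Lemma cocycle_head a n : eps a (idem k (head a) *: n) = eps a n.
Proof.
have [e <-] := g_surj n; rewrite -linearZ /= !epsE scalerA arrow_head.
by rewrite r_idem scalerA arrow_head.
Qed.

(** Adding the trace-free delta of the maps r a^* turns the sum into r applied to delta of [hstar],
    that is, into r f v = v. *)
Lemma cocycle_trace :
  \sum_a ktr BM (fun m => eps a (gstar a m)) = ktr BM (fun m => wt *: m).
Proof.
have rhk a : klin (fun m => r (hstar a m)) by exact: (klin_comp rk).
rewrite -ktr_sum -[LHS]addr0 -(ktr_delta BM rhk) -ktrD; apply: eq_ktr => m.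
rewrite -[RHS]rf -delta_hstarE /delta (klin_sum rk) -big_split.
by apply: eq_bigr => a _; rewrite /gstar epsE (klinB rk) /= addrA subrK.
Qed.

(* The cocycle c defines an extension of X by M. It is trivial, or else, f being
   left almost split, it receives a map from E extending the identity of M;
   the induced map s on quotients pulls the extension back to that of N. *)
Lemma cocycle_dichotomy (X : lmodType A) (c : arr Q -> X -> M) : fin_dim X ->
  (forall a, klin (c a)) ->
  (forall a x, idem k (tail a) *: c a x = c a x) ->
  (forall a x, c a (idem k (head a) *: x) = c a x) ->
  (exists z : X -> M,
     [/\ klin z, forall i x, z (idem k i *: x) = idem k i *: z x
       & forall a x, c a x = z (arrow k a *: x) - arrow k a *: z x]) \/
  (exists (s : {linear N -> X}) (z : N -> M), klin z /\
     forall a n, c a (s n) = eps a n + (z (arrow k a *: n) - arrow k a *: z n)).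
Proof.
move=> X_fd ck ct ch; have [i iE] := ext_incl ck ct ch.
have [[q qi]|ni] := pselect (split_mono i).
  (* Applying q to a (0, x) = (c_a x, a x) shows that this sign gives the coboundary formula. *)
  left; exists (fun x => - q (0, x)); split=> [d x y|j x|a x].
  - have := klin_comp (linear_klin q) (ext_snd_klin ck ct ch) d x y => /= ->.
    by rewrite opprD scalerN.
  - by rewrite scalerN -linearZ /= ext_idem scaler0.
  - rewrite scalerN opprK -linearZ /= ext_arrow scaler0 add0r.
    have -> : (c a x, arrow k a *: x) =
        i (c a x) + (0, arrow k a *: x) :> rep_mod (ext_rep ck ct ch).
      by rewrite iE; congr pair; rewrite /= ?addr0 ?add0r.
    by rewrite linearD qi addrC addrK.
have fF := ext_fin_dim ck ct ch (frame_fin_dim BM) X_fd.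
have [w wf] := f_left.2 _ fF i ni.
have [p pE] := ext_proj ck ct ch.
have [|s sE] := linear_factor (h := p \o w) g_surj.
  by move=> _ /ker_g[m <-]; rewrite /= wf iE pE.
have w1k : klin (fun e => (w e).1 : M).
  by move=> d x y; rewrite (linearP w); exact: ext_fst_klin.
(* On the image of f both the M-component of w and r recover m, so their difference descends to
   N. *)
have [|z zk zE] := klin_factor g_surj (klin_sub w1k rk).
  by move=> _ /ker_g[m <-]; rewrite wf iE rf subrr.
right; exists s, z; split=> // a n; have [e <-] := g_surj n.
have := linearZ_LR w (arrow k a) e.
rewrite [w e]surjective_pairing => /(congr1 fst); rewrite ext_arrow /= => w1.
rewrite sE -linearZ /= !zE w1 pE epsE scalerBr.
set x := r (_ *: e); set y := _ *: r e; set u := arrow k a *: _.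
by rewrite opprB addrACA addKr [x + _]addrC subrK [u + _]addrC addrK.
Qed.

Lemma right_almost_split_of_left : right_almost_split g.
Proof.
split=> [/(split_epi_mono fg_exact)|X X_fd u nu]; first exact: f_left.1.
have N_fd := frame_fin_dim BN.
(* The dichotomy for the pullback of the class along u: if it is trivial, u lifts to E. *)
have [|||[z [zk zi zE]]|[s [z [zk zE]]]] :=
    @cocycle_dichotomy X (fun a x => eps a (u x)) X_fd.
- by move=> a; apply: (klin_comp (eps_klin a)); exact: linear_klin.
- by move=> a x; rewrite cocycle_tail.
- by move=> a x; rewrite linearZ cocycle_head.
(* q is the k-linear section of g attached to r. Adding f z to q u restores compatibility with the
   arrows. *)
- have [||q qk qE] := klin_factor g_surj (h := fun e => e - f (r e)).
  + apply: klin_sub; first by [].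
    by apply: klin_comp rk; exact: linear_klin.
  + by move=> _ /ker_g[m <-]; rewrite rf subrr.
  have gq n : g (q n) = n.
    by have [e <-] := g_surj n; rewrite qE linearB gf subr0.
  have hl : linear (fun x => q (u x) + f (z x)).
    apply: klin_linear => [|i x|a x].
    + apply: klin_add; first by apply: (klin_comp qk); exact: linear_klin.
      by apply: klin_comp zk; exact: linear_klin.
    + rewrite zi !linearZ scalerDr; congr (_ + _).
      have [e eE] := g_surj (u x); rewrite -eE -linearZ /= !qE scalerBr.
      by rewrite r_idem linearZ.
    + have [e eE] := g_surj (u x).
      have zx : z (arrow k a *: x) = eps a (u x) + arrow k a *: z x.
        by rewrite zE subrK.
      have qa : q (arrow k a *: u x) = arrow k a *: q (u x) - f (eps a (u x)).
        rewrite -eE epsE (linearB f) (linearZ_LR f) -(linearZ_LR g) !qE.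
        by rewrite scalerBr opprB addrA subrK.
      rewrite (linearZ_LR u) qa zx (linearD f) (linearZ_LR f) scalerDr.
      by rewrite addrA subrK.
  have [h hE] := linear_pack hl; exists h => x.
  by rewrite hE linearD gq gf addr0.
pose kappa : {linear N -> N} := u \o s.
have epsK a n :
    eps a (kappa n) = eps a n + (z (arrow k a *: n) - arrow k a *: z n).
  exact: zE.
(* The families attached to the endomorphisms t kappa of N; [gstar] itself is attached to the
   identity. *)
pose K (h : arr Q -> M -> N) :=
  exists t : {linear N -> N}, h = fun a m => t (kappa (gstar a m)).
have [[t tE]|nK] := pselect (K gstar).
  have tk : forall n, t (kappa n) = n.
    have e : (t \o kappa) =1 (idfun : N -> N).
      by apply: gstar_ext => a m; rewrite -[RHS]/(gstar a m) tE.
    exact: e.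
  have ki : injective kappa by exact: (can_inj tk).
  have kb : bijective kappa.
    apply: bijective_inj_surj => //.
    exact: (klin_endo_surj N_fd (linear_klin kappa) ki).
  have [l [_ kl]] := bij_linear_inv kb.
  by case: nu; exists (s \o l) => n; exact: kl.
have [|d h1 h2 [t1 ->] [t2 ->]|//|c0 [c0k c0K c0w]] := kseparate BM BN _ _ _ nK.
- exists (\0 : N -> N); by [].
- have tl : linear (fun n => d%:A *: t1 n + t2 n).
    move=> a x y; rewrite (linearP t1) (linearP t2) (scalerDr d%:A).
    by rewrite (scalerDr a) kscaleC addrACA.
  have [t tE] := linear_pack tl; exists t.
  by apply: funext => a; apply: funext => m; rewrite tE.
(* Truncation makes the separating functional a cocycle without changing its pairing with
   morphisms. *)
pose c a n := idem k (tail a) *: c0 a (idem k (head a) *: n).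
have ck a : klin (c a).
  by apply: klin_scale; apply: (klin_comp (c0k a)); exact: scale_klin.
have ctr (h : {linear N -> N}) : \sum_a ktr BM (fun m => c a (h (gstar a m))) =
    \sum_a ktr BM (fun m => c0 a (h (gstar a m))).
  apply: eq_bigr => a _; rewrite /c.
  rewrite (ktrC BM BM (scale_klin (idem k (tail a)))); last first.
    apply: (klin_comp (c0k a)); apply: klin_scale.
    by apply: (klin_comp (linear_klin h)).
  apply: eq_ktr => m; rewrite -linearZ /= /gstar hstar_tail.
  by rewrite -linearZ /= hstar_head.
have [||[y [yk _ yE]]|[t [y [yk yE]]]] := cocycle_dichotomy N_fd ck.
- by move=> a n; rewrite /c scalerA idemE eqxx.
- by move=> a n; rewrite /c scalerA idemE eqxx.
(* A trivial class would pair to zero with the identity. *)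
- case/eqP: c0w; rewrite -[LHS](ctr idfun) -[RHS](pairing_coboundary idfun yk).
  by apply: eq_bigr => a _; apply: eq_ktr => m; rewrite /= yE.
case/eqP: ktr_wt; rewrite -cocycle_trace.
transitivity (\sum_a ktr BM (fun m => c0 a (t (kappa (gstar a m)))));
  last first.
  apply: c0K; last by exists t.
  move=> a; apply: (klin_comp (linear_klin t)).
  by apply: (klin_comp (linear_klin kappa)).
(* Up to coboundaries c t kappa = eps kappa = eps, so the vanishing pairing of c with t kappa equals
   that of eps with the identity. *)
rewrite -(ctr (t \o kappa)); symmetry.
transitivity (\sum_a (ktr BM (fun m => eps a (gstar a m)) +
   ktr BM (fun m => z (arrow k a *: gstar a m) - arrow k a *: z (gstar a m)) +
   ktr BM (fun m => y (arrow k a *: kappa (gstar a m)) -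
                    arrow k a *: y (kappa (gstar a m))))).
  apply: eq_bigr => a _; rewrite -!ktrD; apply: eq_ktr => m.
  by rewrite /= yE epsK.
rewrite !big_split /= (pairing_coboundary idfun zk).
by rewrite (pairing_coboundary kappa yk) !addr0.
Qed.

End RightAlmostSplit.

Theorem theorem1p9 (k : fieldType) (Q : quiver)
  (Qconn : connected Q) (Qacyc : acyclic Q)
  (v : vert Q -> k) (v_regular : regular_weight v)
  (M : lmodType (path_alg k Q))
  (M_fd : fin_dim M) (M_indec : indecomposable M)
  (M_ninj : ~ injective_module M) :
  injective (wrho_mod v M) /\ AR_sequence (wrho_mod v M) (proj_mod v M).
Proof.
have [B _] := fin_dim_frame M_fd.
have v0 := regular_sincere v_regular.
have Finj := wrho_mod_inj B v0 v_regular M_indec M_ninj.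
have E_fd : fin_dim (tens (heisenberg_deg v 1) M) by exact: tens_fin_dim.
have N_fd : fin_dim (tens (preprojective_deg k Q 1) M) by exact: tens_fin_dim.
have FG : short_exact (wrho_mod v M) (proj_mod v M).
  split=> // [t|e]; first exact: proj_mod_surj.
  by split=> [|[m <-]]; [exact: ker_proj_mod|exact: proj_wrho].
have Fleft : left_almost_split (wrho_mod v M).
  split; first exact: (wrho_mod_not_split B).
  move=> X X_fd u us; apply: (wrho_mod_extend (B := B)) => // psi.
  exact: ktr_not_split_mono.
split=> //; split=> //; split=> //.
have [BN _] := fin_dim_frame N_fd.
have [r [rk ri rf]] := equivariant_retraction B E_fd FG.
have [eps epsP] := cocycle_exists FG rk rf.
apply: (@right_almost_split_of_left k Q M _ _ _ _ (tstar (heisenberg_rel v))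
  (weight_elt v) B BN FG Fleft _ _ _ _ _ _ r rk ri rf eps).
- exact: tstar_klin.
- exact: tstar_tail.
- exact: tstar_head.
- by move=> m; rewrite delta_hstar.
- exact: ktr_weight.
- move=> s t st; apply: tens_star_ext => a m.
  by have := st a m; rewrite proj_mod_star.
- by move=> a; case: (epsP a).
- by move=> a; case: (epsP a).
Qed.
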